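(* Let $\mu$ be a sum of dominant minuscule coweights for the group $\mathrm{GSp}_{2n}$. Then $\mathrm{Adm}(\mu)=\mathrm{Perm}(\mu)$, where both sets are the subsets of the extended affine Weyl group $\widetilde W(\mathrm{GSp}_{2n})$ defined with respect to the root system of $\mathrm{GSp}_{2n}$.
   Context: Root system of $\mathrm{GSp}_{2n}$: for $1\le i\le 2n$ put $\bar i=2n+1-i$. Let $X_*=\{z\in\mathbb Z^{2n}: z_i+z_{\bar i}\text{ is independent of }i\}$, $X^*=\mathrm{Hom}(X_*,\mathbb Z)$ with canonical pairing $\langle\ ,\ \rangle$, and $V=X_*\otimes\mathbb R\subset\mathbb R^{2n}$. The set $R$ of roots consists of the restrictions to $X_*$ of the functionals $z\mapsto z_i-z_j$, $i\ne j$; the coroot of such a root is $e_i-e_j+e_{\bar j}-e_{\bar i}$ if $j\ne\bar i$ and $e_i-e_{\bar i}$ if $j=\bar i$ ($e_i$ the standard basis vectors). Positive roots are those with $i<j$; the simple roots $\Pi$ are the restrictions of $z_i-z_{i+1}$, $1\le i\le n$; the highest root is $\tilde\alpha=z_1-z_{2n}$. The finite Weyl group $W_0$ is the group of permutations $\sigma\in S_{2n}$ with $\sigma(\bar i)=\overline{\sigma(i)}$, acting by permuting coordinates. A coweight is an element $\nu\in X_*$; it is dominant if $\langle\alpha,\nu\rangle\ge0$ for all $\alpha\in\Pi$, and minuscule if $\langle\alpha,\nu\rangle\in\{-1,0,1\}$ for every root $\alpha$. Affine Weyl groups: for $\alpha\in R$, $k\in\mathbb Z$, let $s_{\alpha,k}(x)=x-(\langle\alpha,x\rangle-k)\check\alpha$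 on $V$, with fixed hyperplane $H_{\alpha,k}$; put $s_\alpha=s_{\alpha,0}$. $W_{\rm aff}$ is the group generated by all $s_{\alpha,k}$; it is a Coxeter group with generators $S_{\rm aff}=\{s_\alpha:\alpha\in\Pi\}\cup\{s_{\tilde\alpha,1}\}$. Alcoves are the connected components of $V-\bigcup_{\alpha\in R,k\in\mathbb Z}H_{\alpha,k}$; the base alcove is $A_0=\{x\in V:\langle\alpha,x\rangle>0\ \forall\alpha\in\Pi,\ \langle\tilde\alpha,x\rangle<1\}$. The extended affine Weyl group $\widetilde W(\mathrm{GSp}_{2n})=X_*\rtimes W_0$ ($\lambda\in X_*$ acting as the translation $t_\lambda$) acts on alcoves; $\Omega$ is the stabilizer of $A_0$, and $\widetilde W(\mathrm{GSp}_{2n})=W_{\rm aff}\rtimes\Omega$. Bruhat order: for $w,w'\in W_{\rm aff}$, $\tau,\tau'\in\Omega$, $w\tau\le w'\tau'$ iff $w\le w'$ in the Bruhat order of $(W_{\rm aff},S_{\rm aff})$ and $\tau=\tau'$. A vertex of $A_0$ is any point of a facet of minimal dimension of the closure of $A_0$; the minimal facets are lines parallel to $(1,\dots,1)$, and the condition below does not depend on the choice of the point in the facet. Representatives are $0$ and $\eta_i=\tfrac12(\omega_i+\omega_{2n-i})$, $1\le i\le n$, where $\omega_i=(1^i,0^{2n-i})$. For $\mu$ dominant let $\tau\in\Omega$ be the unique element with $t_\mu\in W_{\rm aff}\tau$, and let $\mathrm{Conv}(\mu)$ be the convex hull of $W_0(\mu)$. Then $\mathrm{Adm}(\mu)=\{x\in\widetilde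 W(\mathrm{GSp}_{2n}): x\le t_\lambda\text{ for some }\lambda\in W_0(\mu)\}$, and $\mathrm{Perm}(\mu)$ is the set of $x\in W_{\rm aff}\tau$ such that $x(a)-a\in\mathrm{Conv}(\mu)$ for every vertex $a$ of $A_0$. *)

(* Defs.v *)
From HB Require Import structures.
From mathcomp Require Import all_boot all_order all_algebra all_fingroup.
From mathcomp Require Import boolp classical_sets reals topology normedtype.
From Stdlib Require Import Relation_Operators.

Set Implicit Arguments.
Unset Strict Implicit.
Unset Printing Implicit Defensive.

Import Order.TTheory GRing.Theory Num.Theory.
Import numFieldTopology.Exports numFieldNormedType.Exports.

Local Open Scope classical_set_scope.
Local Open Scope ring_scope.

(* Coordinates are numbered from 0, so that the involution i |-> 2n+1-i on
   {1, ..., 2n} becomes i |-> 2n-1-i on 'I_(2 * n), which is rev_ord. *)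
Definition gsp_pred (K : pzRingType) (n : nat) : {pred 'rV[K]_(2 * n)} :=
  [pred z : 'rV[K]_(2 * n) | [forall i, [forall j,
     z 0 i + z 0 (rev_ord i) == z 0 j + z 0 (rev_ord j)]]].

Lemma gsp_predP (K : pzRingType) n (z : 'rV[K]_(2 * n)) :
  reflect (forall i j, z 0 i + z 0 (rev_ord i) = z 0 j + z 0 (rev_ord j))
          (z \in @gsp_pred K n).
Proof.
apply: (iffP forallP) => h i; last by apply/forallP => j; apply/eqP/h.
by move=> j; apply/eqP; move/forallP: (h i); apply.
Qed.

Fact gsp_submod_closed (K : pzRingType) n : submod_closed (@gsp_pred K n).
Proof.
split=> [|a u v /gsp_predP hu /gsp_predP hv]; apply/gsp_predP => i j.
  by rewrite !mxE.
by rewrite !mxE addrACA -mulrDr (hu i j) (hv i j) mulrDr addrACA.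
Qed.

HB.instance Definition _ (K : pzRingType) n :=
  GRing.isSubmodClosed.Build K 'rV[K]_(2 * n) (@gsp_pred K n)
    (gsp_submod_closed K n).

(* gspvec int n is X_*, and gspvec R n, for R the reals, is V. *)
Record gspvec (K : pzRingType) (n : nat) : Type :=
  GspVec { gspval : 'rV[K]_(2 * n); gspvalP : gspval \in @gsp_pred K n }.

HB.instance Definition _ (K : pzRingType) n := [isSub for @gspval K n].
HB.instance Definition _ (K : pzRingType) n :=
  [Choice of gspvec K n by <:].
HB.instance Definition _ (K : pzRingType) n :=
  [SubChoice_isSubLmodule of gspvec K n by <:].

Definition coweight (n : nat) := gspvec int n.

Fact gsp_real_subproof (R : pzRingType) n (z : coweight n) :
  map_mx intr (gspval z) \in @gsp_pred R n.
Proof.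
apply/gsp_predP => i j.
by rewrite !mxE -!rmorphD (gsp_predP _ (gspvalP z) i j).
Qed.

(* The inclusion of X_* in V. *)
Definition gsp_real (R : pzRingType) n (z : coweight n) : gspvec R n :=
  GspVec (gsp_real_subproof R z).

(* The root z_i - z_j is presented by the pair (i, j). The pairs (i, j) and
   (rev_ord j, rev_ord i) present the same root; they also give the same
   coroot. *)
Definition gsp_root (n : nat) := {a : 'I_(2 * n) * 'I_(2 * n) | a.1 != a.2}.

Definition pairing (K : pzRingType) n (a : gsp_root n) (x : gspvec K n) : K :=
  gspval x 0 (val a).1 - gspval x 0 (val a).2.

Definition coroot_val (K : pzRingType) n (a : gsp_root n) : 'rV[K]_(2 * n) :=
  let: (i, j) := val a in
  if j == rev_ord i then delta_mx 0 i - delta_mx 0 (rev_ord i)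
  else delta_mx 0 i - delta_mx 0 j
       + delta_mx 0 (rev_ord j) - delta_mx 0 (rev_ord i).

Fact coroot_subproof (K : pzRingType) n (a : gsp_root n) :
  coroot_val K a \in @gsp_pred K n.
Proof.
have rE k l : (rev_ord k == l :> 'I_(2 * n)) = (k == rev_ord l).
  by rewrite -(inj_eq rev_ord_inj) rev_ordK.
suff h k : coroot_val K a 0 k + coroot_val K a 0 (rev_ord k) = 0.
  by apply/gsp_predP => i j; rewrite !h.
rewrite /coroot_val; case: (val a) => i j.
case: ifP => _; rewrite !mxE !eqxx /= !rE !rev_ordK.
  by rewrite addrA subrK subrr.
by rewrite !addrA subrK addrK subrK subrr.
Qed.

Definition coroot (K : pzRingType) n (a : gsp_root n) : gspvec K n :=
  GspVec (coroot_subproof K a).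

Definition simple_root n (a : gsp_root n) : bool :=
  ((val a).1 < n)%N && ((val a).2 == (val a).1.+1 :> nat).

Definition highest_root n (a : gsp_root n) : bool :=
  ((val a).1 == 0 :> nat) && ((val a).2 == (2 * n).-1 :> nat).

Definition dominant n (nu : coweight n) : Prop :=
  forall a : gsp_root n, simple_root a -> 0 <= pairing a nu.

Definition minuscule n (nu : coweight n) : Prop :=
  forall a : gsp_root n, pairing a nu \in [:: -1; 0; 1].

Definition sum_of_dominant_minuscule n (mu : coweight n) : Prop :=
  exists s : seq (coweight n),
    (forall nu, nu \in s -> dominant nu /\ minuscule nu) /\
    mu = \sum_(nu <- s) nu.

Definition weyl (n : nat) :=
  {s : 'S_(2 * n) | [forall i, s (rev_ord i) == rev_ord (s i)]}.

Fact weyl_act_subproof (K : pzRingType) n (s : weyl n) (x : gspvec K n) :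
  col_perm (val s)^-1%g (gspval x) \in @gsp_pred K n.
Proof.
have h k : (val s)^-1%g (rev_ord k) = rev_ord ((val s)^-1%g k).
  apply: (@perm_inj _ (val s)).
  by rewrite permKV (eqP (forallP (valP s) _)) permKV.
by apply/gsp_predP => i j; rewrite !mxE !h; apply: (gsp_predP _ (gspvalP x)).
Qed.

(* The left action with s(e_i) = e_(s i), i.e. (s x)_(s i) = x_i. *)
Definition weyl_act (K : pzRingType) n (s : weyl n) (x : gspvec K n) :
  gspvec K n := GspVec (weyl_act_subproof s x).

Definition translation (R : pzRingType) n (lambda : coweight n)
  (x : gspvec R n) : gspvec R n := x + gsp_real R lambda.

(* The extended affine Weyl group, as a group (under composition) of affine
   transformations of V; for n > 0 this action of X_* ><| W_0 is faithful. *)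
Definition Wext (R : pzRingType) n : set (gspvec R n -> gspvec R n) :=
  [set w | exists (lambda : coweight n) (s : weyl n),
     w = translation lambda \o weyl_act s].

Definition affine_reflection (R : pzRingType) n (a : gsp_root n) (k : int)
  (x : gspvec R n) : gspvec R n := x - (pairing a x - k%:~R) *: coroot R a.

Section InvolutionGroups.
Variables (T : Type) (S : set (T -> T)).

Inductive is_word : nat -> (T -> T) -> Prop :=
| is_word0 : is_word 0 idfun
| is_wordS k s w : S s -> is_word k w -> is_word k.+1 (s \o w).

(* When S consists of involutions this is the group generated by S. *)
Definition generated : set (T -> T) := [set w | exists k, is_word k w].

Definition has_length (w : T -> T) (k : nat) : Prop :=
  is_word k w /\ forall m, is_word m w -> (k <= m)%N.

Definition conjugate_of_generator (t : T -> T) : Prop :=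
  exists w w' s, [/\ generated w, cancel w w', cancel w' w, S s
                   & t = w \o s \o w'].

Definition bruhat_step (u v : T -> T) : Prop :=
  exists t k l, [/\ conjugate_of_generator t, v = t \o u,
                    has_length u k, has_length v l & (k < l)%N].

Definition bruhat_le : (T -> T) -> (T -> T) -> Prop :=
  clos_refl_trans (T -> T) bruhat_step.

End InvolutionGroups.

Section AdmissiblePermissible.
Variables (R : realType) (n : nat).
Local Notation V := (gspvec R n).

Definition Waff : set (V -> V) :=
  generated [set s | exists (a : gsp_root n) (k : int), s = affine_reflection a k].

Definition Saff : set (V -> V) :=
  [set s | exists a : gsp_root n, simple_root a /\ s = affine_reflection a 0]
  `|` [set s | exists a : gsp_root n, highest_root a /\ s = affine_reflection a 1].

Definition base_alcove : set V :=
  [set x | (forall a : gsp_root n, simple_root a -> 0 < pairing a x) /\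
           (forall a : gsp_root n, highest_root a -> pairing a x < 1)].

Definition Omega : set (V -> V) :=
  [set w | Wext w /\ w @` base_alcove = base_alcove].

Definition Wext_le (x y : V -> V) : Prop :=
  exists w w' tau,
    [/\ Waff w, Waff w', Omega tau, x = w \o tau & y = w' \o tau]
    /\ bruhat_le Saff w w'.

(* The closure is taken in R^2n, of which V is a closed subspace. *)
Definition closed_base_alcove : set V :=
  [set x | closure (@gspval R n @` base_alcove) (gspval x)].

(* The facet through x of the arrangement of all hyperplanes H_(alpha, k). *)
Definition facet (x : V) : set V :=
  [set y | forall (a : gsp_root n) (k : int),
     Num.sg (pairing a y - k%:~R) = Num.sg (pairing a x - k%:~R)].

(* The dimension of (the affine span of) F is d. *)
Definition has_dim (F : set V) (d : nat) : Prop :=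
  exists U : {vspace 'rV[R]_(2 * n)},
    [/\ \dim U = d,
        forall x y, F x -> F y -> gspval x - gspval y \in U
      & forall U' : {vspace 'rV[R]_(2 * n)},
          (forall x y, F x -> F y -> gspval x - gspval y \in U') ->
          (U <= U')%VS].

Definition vertex (x : V) : Prop :=
  closed_base_alcove x /\
  exists d, has_dim (facet x) d /\
    forall y e, closed_base_alcove y -> has_dim (facet y) e -> (d <= e)%N.

Definition weyl_orbit (mu : coweight n) : set (coweight n) :=
  [set lambda | exists s : weyl n, lambda = weyl_act s mu].

Definition Conv (mu : coweight n) : set V :=
  [set x | exists c : weyl n -> R,
     [/\ forall s, 0 <= c s, \sum_s c s = 1
       & x = \sum_s c s *: gsp_real R (weyl_act s mu)]].

Definition Adm (mu : coweight n) : set (V -> V) :=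
  [set x | Wext x /\
     exists lambda, weyl_orbit mu lambda /\ Wext_le x (translation lambda)].

Definition Waff_coset (tau : V -> V) : set (V -> V) :=
  [set x | exists w, Waff w /\ x = w \o tau].

Definition Perm (mu : coweight n) : set (V -> V) :=
  [set x | exists tau,
     [/\ Omega tau, Waff_coset tau (translation mu), Waff_coset tau x
       & forall a : V, vertex a -> Conv mu (x a - a)]].

End AdmissiblePermissible.

Arguments Adm R {n} mu.
Arguments Perm R {n} mu.

(* Main.v *)
Require Import Defs.
From mathcomp Require Import all_boot all_order all_algebra.
From mathcomp Require Import boolp classical_sets reals.
From mathcomp Require Import fingroup perm topology normedtype.
From mathcomp Require Import ring lra zify.
From Stdlib Require Import Relation_Operators.
Import Defs.

Set Implicit Arguments.
Unset Strict Implicit.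
Unset Printing Implicit Defensive.

Import Order.TTheory GRing.Theory Num.Theory.
Import numFieldTopology.Exports numFieldNormedType.Exports.

Local Open Scope classical_set_scope.
Local Open Scope ring_scope.

(** The proof reduces the theorem to the position of a single point. A sum mu of
    dominant minuscule coweights has n coordinates B followed by n coordinates
    A, with A <= B ([block_sum]). So Conv(mu) lies in the box of all v in V with
    A <= v_i <= B and v_i + v_(rev i) = A + B ([Conv_box]), and the coweights in
    the box all of whose coordinates are A or B form the orbit of mu
    ([orbit_of_corners]). Let rho be the barycentre of the base alcove A_0.

    Permissible elements are admissible. If x is permissible then x(rho) - rho,
    a mean of vectors x(a) - a with a a vertex, lies in the box
    ([permissible_box]). As long as some coordinate of x(rho) - rho differs from
    A and B, there is a hyperplane H, with rho and x(rho) on the same side, such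
    that s_H x(rho) - rho still lies in the box ([integral_ascent], [ascent]).
    Replacing x by s_H x goes up in the Bruhat order, and takes x(rho) farther
    away from rho. This cannot go on for ever: the coordinates of 2n (x(rho) -
    rho) are integers, and they are bounded on the box. When it stops, all
    coordinates of x(rho) - rho are A or B. As the coordinates of rho are
    incongruent modulo 1, x is then a translation, by an element of the orbit of
    mu ([climb]).

    Admissible elements are permissible. If s_H x is longer than x, then A_0 and
    x(A_0) are on the same side of H; hence for a in the closure of A_0 the
    vector x(a) - a lies on the segment from s_H x(a) - a to its image under the
    linear part of s_H ([Conv_descent]). The hull Conv(mu) contains this segment
    as soon as it contains s_H x(a) - a, and one can descend along the Bruhat
    order from a translation by an element of the orbit ([bruhat_Conv]).

    Both arguments compare lengths in W_aff by means of the position of alcoves: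
    s_H w is longer than w if and only if H does not separate A_0 from w(A_0)
    ([bruhat_step_up], [bruhat_step_inv]). This comes from the strong exchange
    condition ([strong_exchange]) and from the conjugacy of every s_H to a
    simple reflection ([reflection_conjugate]). The side of H on which w(A_0)
    lies is read off the sign at w(rho) of the affine root defining H. *)

Local Notation crd v i := (gspval v 0 i).

(** * Coordinates, coroots and the finite Weyl group *)

Section Coordinates.
Variables (K : pzRingType) (n : nat).
Implicit Types (u v : gspvec K n) (i : 'I_(2 * n)).

Lemma gspvec_eq u v : (forall i, crd u i = crd v i) -> u = v.
Proof. by move=> e; apply: val_inj; apply/rowP. Qed.

Lemma crdD u v i : crd (u + v) i = crd u i + crd v i.
Proof. by rewrite [gspval _](raddfD val) mxE. Qed.

Lemma crdN u i : crd (- u) i = - crd u i.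
Proof. by rewrite [gspval _](raddfN val) mxE. Qed.

Lemma crdB u v i : crd (u - v) i = crd u i - crd v i.
Proof. by rewrite crdD crdN. Qed.

Lemma crdZ (c : K) u i : crd (c *: u) i = c * crd u i.
Proof. by rewrite [gspval _](GRing.valZ c u) mxE. Qed.

Lemma crd_sum (I : Type) (r : seq I) (P : pred I) (F : I -> gspvec K n) i :
  crd (\sum_(j <- r | P j) F j) i = \sum_(j <- r | P j) crd (F j) i.
Proof. by rewrite [gspval _](raddf_sum val) summxE. Qed.

Lemma crd_rev u i j :
  crd u i + crd u (rev_ord i) = crd u j + crd u (rev_ord j).
Proof. exact: (gsp_predP _ (gspvalP u)). Qed.

Lemma crd_weyl (s : weyl n) u i : crd (weyl_act s u) i = crd u ((val s)^-1%g i).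
Proof. by rewrite mxE. Qed.

Lemma crd_real (l : coweight n) i : crd (gsp_real K l) i = (crd l i)%:~R.
Proof. by rewrite mxE. Qed.

End Coordinates.

Lemma crd_coroot_int (K : pzRingType) n (a : gsp_root n) i :
  crd (coroot K a) i = (crd (coroot int a) i)%:~R.
Proof.
rewrite /= /coroot_val; case: (val a) => p q.
by case: ifP => _; rewrite !mxE !rmorphD ?rmorphN /= !rmorph_nat.
Qed.

Lemma eq_ordE m (i j : 'I_m) : (i == j) = (i == j :> nat).
Proof. by []. Qed.

(** For a long root the two indices in each test coincide, so that one formula
    serves both kinds of coroots. *)
Lemma coroot_coef n (a : gsp_root n) i :
  crd (coroot int a) i =
    if (i == (val a).1) || (i == rev_ord (val a).2) then 1
    else if (i == (val a).2) || (i == rev_ord (val a).1) then -1 else 0.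
Proof.
rewrite /= /coroot_val; case: a => -[p q] /=; rewrite eq_ordE => pq.
have [hi hp hq] := And3 (ltn_ord i) (ltn_ord p) (ltn_ord q).
case: ifP; rewrite !mxE !eqxx /= ?natz !eq_ordE /= => ?;
  by (do 2?case: ifP); lia.
Qed.

(** For a long root, p and q are dual and the last two tests repeat the first. *)
Definition refl_ord n (a : gsp_root n) (i : 'I_(2 * n)) : 'I_(2 * n) :=
  let: (p, q) := val a in
  if i == p then q else if i == q then p
  else if i == rev_ord p then rev_ord q
  else if i == rev_ord q then rev_ord p else i.

Lemma eq_rev_ord m (i j : 'I_m) : (rev_ord i == j) = (i == rev_ord j).
Proof. by rewrite -(inj_eq rev_ord_inj) rev_ordK. Qed.

(** The number of coordinates is even, so the involution has no fixed point. *)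
Lemma rev_ord_neq n (i : 'I_(2 * n)) : (i == rev_ord i) = false.
Proof. by apply/eqP => /(congr1 val) /=; have := ltn_ord i; lia. Qed.

Lemma crd_coroot_rev n (a : gsp_root n) i :
  crd (coroot int a) (rev_ord i) = - crd (coroot int a) i.
Proof.
apply/eqP; rewrite -addr_eq0 addrC (crd_rev _ i (val a).1) !coroot_coef.
by rewrite !eqxx (inj_eq rev_ord_inj) (negbTE (valP a)) [_ == (val a).1]eq_sym
  rev_ord_neq /= orbT.
Qed.

Lemma refl_ordK n (a : gsp_root n) : involutive (refl_ord a).
Proof.
case: a => -[p q] pq i; rewrite /refl_ord /=; move: pq => /= /negbTE pq.
have [->|ip] := eqVneq i p; first by rewrite eqxx (eq_sym q) pq.
have [->|iq] := eqVneq i q; first by rewrite eqxx.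
have [e|ip'] := eqVneq i (rev_ord p).
  by rewrite !eq_rev_ord !rev_ordK !rev_ord_neq (eq_sym q p) pq eqxx -e
       (eq_sym q i) (negbTE iq).
have [e|iq'] := eqVneq i (rev_ord q).
  by rewrite !eq_rev_ord !rev_ordK !rev_ord_neq eqxx -e (eq_sym p i) (negbTE
    ip).
by rewrite (negbTE ip) (negbTE iq) (negbTE ip') (negbTE iq').
Qed.

Lemma refl_ord_rev n (a : gsp_root n) i :
  refl_ord a (rev_ord i) = rev_ord (refl_ord a i).
Proof.
case: a => -[p q] pq; rewrite /refl_ord /=; move: pq => /= /negbTE pq.
rewrite !eq_rev_ord !rev_ordK.
have [->|ip] := eqVneq i p; first by rewrite rev_ord_neq; case: eqP.
have [->|iq] := eqVneq i q; first by rewrite rev_ord_neq; case: eqP.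
by case: eqP => _; [|case: eqP => _]; rewrite ?rev_ordK.
Qed.

Fact refl_weyl_subproof n (a : gsp_root n) :
  [forall i, perm (can_inj (refl_ordK a)) (rev_ord i)
             == rev_ord (perm (can_inj (refl_ordK a)) i)].
Proof. by apply/forallP => i; rewrite !permE refl_ord_rev. Qed.

Definition refl_weyl n (a : gsp_root n) : weyl n :=
  Sub (perm (can_inj (refl_ordK a))) (refl_weyl_subproof a).

Lemma refl_weylV n (a : gsp_root n) i : (val (refl_weyl a))^-1%g i
  = refl_ord a i.
Proof. by apply: (@perm_inj _ (val (refl_weyl a)));
  rewrite permKV permE refl_ordK. Qed.

Lemma weyl_actZ (K : pzRingType) n (s : weyl n) (c : K) (u : gspvec K n) :
  weyl_act s (c *: u) = c *: weyl_act s u.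
Proof. by apply: gspvec_eq => i; rewrite crdZ !crd_weyl crdZ. Qed.

Lemma weyl_actB (K : pzRingType) n (s : weyl n) (u v : gspvec K n) :
  weyl_act s (u - v) = weyl_act s u - weyl_act s v.
Proof. by apply: gspvec_eq => i; rewrite crdB !crd_weyl crdB. Qed.

Fact weyl1_subproof n :
  [forall i, (1 : 'S_(2 * n))%g (rev_ord i) == rev_ord ((1 : 'S_(2 * n))%g i)].
Proof. by apply/forallP => i; rewrite !perm1. Qed.

Definition weyl1 n : weyl n := Sub 1%g (weyl1_subproof n).

Lemma weyl_act1 (K : pzRingType) n (v : gspvec K n) : weyl_act (weyl1 n) v = v.
Proof. by apply: gspvec_eq => i; rewrite crd_weyl invg1 perm1. Qed.

Fact weylM_subproof n (s t : weyl n) :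
  [forall i, (val t * val s)%g (rev_ord i) == rev_ord ((val t * val s)%g i)].
Proof.
by apply/forallP=> i;
  rewrite !permM (eqP (forallP (valP t) _)) (forallP (valP s)).
Qed.

(** Permutations compose from left to right, whereas the action on vectors is a
    left action. *)
Definition weylM n (s t : weyl n) : weyl n :=
  Sub (val t * val s)%g (weylM_subproof s t).

Lemma weyl_actM (K : pzRingType) n (s t : weyl n) (v : gspvec K n) :
  weyl_act (weylM s t) v = weyl_act s (weyl_act t v).
Proof. by apply: gspvec_eq => i; rewrite !crd_weyl /= invMg permM. Qed.

Lemma weylV_rev n (s : weyl n) i :
  (val s)^-1%g (rev_ord i) = rev_ord ((val s)^-1%g i).
Proof.
apply: (@perm_inj _ (val s)).
by rewrite permKV (eqP (forallP (valP s) _)) permKV.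
Qed.

(** * Affine roots and affine transformations *)

Section AffineFunctions.
Variables (R : realType) (n : nat).
Local Notation V := (gspvec R n).
Implicit Types (a b : gsp_root n) (k m : int) (x y : V) (l : coweight n)
  (s t : weyl n).

(** The affine root whose zero set is the hyperplane H_(a, k). *)
Definition level a k x : R := pairing a x - k%:~R.

Definition affine l s : V -> V := @translation R n l \o weyl_act s.

Fact weyl_root_subproof s a :
  ((val s)^-1%g (val a).1, (val s)^-1%g (val a).2).1
    != ((val s)^-1%g (val a).1, (val s)^-1%g (val a).2).2.
Proof. by rewrite /= (inj_eq perm_inj) (valP a). Qed.

(** The root a composed with s. *)
Definition weyl_root s a : gsp_root n := Sub (_, _) (weyl_root_subproof s a).

Lemma crd_affine l s x i :
  crd (affine l s x) i = crd x ((val s)^-1%g i) + (crd l i)%:~R.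
Proof. by rewrite /affine /translation [_ x]/= crdD crd_weyl crd_real. Qed.

Lemma level_affine a k l s x :
  level a k (affine l s x)
  = level (weyl_root s a) (k - crd l (val a).1 + crd l (val a).2) x.
Proof.
rewrite /level /pairing !crd_affine /= rmorphD rmorphB /=; ring.
Qed.

Lemma affineM l s l' t :
  affine l s \o affine l' t = affine (l + weyl_act s l') (weylM s t).
Proof.
apply/funext => x; apply: gspvec_eq => i; rewrite [LHS]crd_affine !crd_affine.
by rewrite crdD crd_weyl rmorphD /= invMg permM [X in _ = _ + X]addrC addrA.
Qed.

Lemma affine0 s : affine 0 s = weyl_act s.
Proof.
apply/funext => x; apply: gspvec_eq => i.
by rewrite crd_affine crd_weyl (_ : crd (0 : coweight n) i = 0) ?addr0 // mxE.
Qed.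

Lemma pairing_coroot a b :
  pairing a (coroot R b) = (pairing a (coroot int b))%:~R.
Proof. by rewrite /pairing !(crd_coroot_int R) rmorphB. Qed.

Lemma pairing_corootxx a : pairing a (coroot int a) = 2.
Proof.
rewrite /pairing !coroot_coef; case: a => -[p q] /= pq.
by rewrite !eqxx !rev_ord_neq (eq_sym q p) (negbTE pq).
Qed.

Lemma level_reflection a k b m x :
  level a k (affine_reflection b m x)
  = level a k x - level b m x * (pairing a (coroot int b))%:~R.
Proof.
rewrite -pairing_coroot /level /affine_reflection /pairing !crdB !crdZ; ring.
Qed.

Lemma level_reflectionxx a k x :
  level a k (affine_reflection a k x) = - level a k x.
Proof. rewrite level_reflection pairing_corootxx; ring. Qed.

Lemma affine_reflectionE a k x :
  affine_reflection a k x = x - level a k x *: coroot R a.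
Proof. by []. Qed.

Lemma affine_reflectionK a k : involutive (@affine_reflection R n a k).
Proof.
move=> x; rewrite [LHS]affine_reflectionE level_reflectionxx.
by rewrite affine_reflectionE scaleNr opprK subrK.
Qed.

Lemma weyl_coroot s a : weyl_act s (coroot R (weyl_root s a)) = coroot R a.
Proof.
apply: gspvec_eq => i; rewrite crd_weyl !(crd_coroot_int R) !coroot_coef /=.
by rewrite -!weylV_rev !(inj_eq perm_inj).
Qed.

(** The rule s_H x = x s_(x^-1 H); the affine root of x^-1 H is the one that
    [level_affine] computes. *)
Lemma reflection_affine a k l s :
  affine_reflection a k \o affine l s
  = affine l s \o affine_reflection (weyl_root s a)
                    (k - crd l (val a).1 + crd l (val a).2).
Proof.
apply/funext => x /=; rewrite !affine_reflectionE level_affine.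
rewrite /affine /translation /= weyl_actB weyl_actZ weyl_coroot.
by rewrite addrAC.
Qed.

Lemma refl_weylE a x :
  weyl_act (refl_weyl a) x = x - pairing a x *: coroot R a.
Proof.
apply: gspvec_eq => i; rewrite crd_weyl refl_weylV crdB crdZ (crd_coroot_int R).
rewrite coroot_coef /refl_ord /pairing; case: a => -[p q] /= pq.
have [->|ip] := eqVneq i p; first by rewrite mulr1; ring.
have [->|iq] := eqVneq i q; first by rewrite rev_ord_neq /=; ring.
have e := crd_rev x p q.
have [->|ip'] := eqVneq i (rev_ord p).
  by rewrite (inj_eq rev_ord_inj) (negbTE pq) /=; lra.
by case: eqP => [->|_]; rewrite /= ?mulr0 ?subr0 ?mulr1 //; lra.
Qed.

Lemma reflection_is_affine a k :
  affine_reflection a k = affine (k *: coroot int a) (refl_weyl a).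
Proof.
apply/funext => x; apply: gspvec_eq => i;
  rewrite crd_affine -crd_weyl refl_weylE.
rewrite affine_reflectionE !crdB !crdZ rmorphM /= -(crd_coroot_int R) /level;
  ring.
Qed.

End AffineFunctions.

(** * The base alcove and its barycentre *)

(** 2n times the value of an affine root at the barycentre, see [level_rho]. *)
Definition height n (a : gsp_root n) (k : int) : int :=
  (val a).2%:Z - (val a).1%:Z - (2 * n)%:Z * k.

Lemma ler_mul2n n (c k : int) : c <= k -> n%:Z * (2 * c) <= n%:Z * (2 * k).
Proof. by move=> ck; apply: ler_wpM2l; lia. Qed.

(** Two distinct indices are not congruent modulo 2n, so that no hyperplane
    passes through rho. *)
Lemma height_neq0 n (a : gsp_root n) (k : int) : height a k != 0.
Proof.
rewrite /height; case: a => -[p q] /=; rewrite eq_ordE => pq.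
have [hp hq] := (ltn_ord p, ltn_ord q).
apply/eqP => e; have {e} : q%:Z - p%:Z = n%:Z * (2 * k) by lia.
have [k0|k0|->] := ltgtP k 0; last by lia.
- have : n%:Z * (2 * k) <= n%:Z * (2 * -1) by apply: ler_mul2n; lia.
  by lia.
- have : n%:Z * (2 * 1) <= n%:Z * (2 * k) by apply: ler_mul2n; lia.
  by lia.
Qed.

Section BaseAlcove.
Variables (R : realType) (n : nat).
Hypothesis n_gt0 : (0 < n)%N.
Local Notation V := (gspvec R n).
Implicit Types (a b : gsp_root n) (k m : int) (x y : V) (l : coweight n)
  (s t : weyl n).

Fact opp_root_subproof a : ((val a).2, (val a).1).1 != ((val a).2, (val a).1).2.
Proof. by rewrite /= eq_sym (valP a). Qed.

Definition opp_root a : gsp_root n := Sub (_, _) (opp_root_subproof a).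

Lemma level_opp a k x : level (opp_root a) (- k) x = - level a k x.
Proof. rewrite /level /pairing /= rmorphN; ring. Qed.

Lemma reflection_opp a k :
  affine_reflection (opp_root a) (- k) = affine_reflection a k :> (V -> V).
Proof.
apply/funext => x; rewrite !affine_reflectionE level_opp scaleNr opprK.
congr (_ + _); rewrite -scalerN; congr (_ *: _).
apply: gspvec_eq => i; rewrite crdN !(crd_coroot_int R) !coroot_coef.
case: a => -[p q] /= /negbTE pq.
have [->|ip] := eqVneq i p.
  by rewrite pq !rev_ord_neq /= mulrNz.
have [->|iq] := eqVneq i q.
  by rewrite !rev_ord_neq /= mulrNz opprK.
case: eqP => [->|] /=; last by case: eqP; rewrite /= ?oppr0 ?opprK.
by rewrite (inj_eq rev_ord_inj) pq /= mulrNz opprK.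
Qed.

Fact rho_subproof :
  \row_(j < 2 * n) (1 - (2 * j + 1)%:R / (4 * n)%:R) \in @gsp_pred R n.
Proof.
suff h (i : 'I_(2 * n)) : (1 - (2 * i + 1)%:R / (4 * n)%:R)
     + (1 - (2 * rev_ord i + 1)%:R / (4 * n)%:R) = 1 :> R.
  by apply/gsp_predP => i j; rewrite !mxE !h.
have n0 : (4 * n)%:R != 0 :> R by rewrite pnatr_eq0; lia.
apply: (mulIf n0); rewrite mulrDl !mulrBl !mulfVK // mul1r.
rewrite addrACA -opprD -!natrD -natrB; last by have := ltn_ord i; rewrite /=;
  lia.
by congr (_%:R); have := ltn_ord i; rewrite /=; lia.
Qed.

(** The barycentre of the base alcove, normalized along the centre so as to be
    the mean of the vertices of [rho_mean]. *)
Definition rho : V := GspVec rho_subproof.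

Lemma crd_rho i : (2 * n)%:R * crd rho i = (2 * n)%:R - i%:R - 2^-1.
Proof.
have n0 : n%:R != 0 :> R by rewrite pnatr_eq0 -lt0n.
by rewrite mxE (natrD _ (2 * i)) !natrM; field.
Qed.

Lemma level_rho a k : (2 * n)%:R * level a k rho = (height a k)%:~R.
Proof.
rewrite /level /pairing !mulrBr !crd_rho /height !rmorphB rmorphM /=.
by rewrite -!pmulrn; ring.
Qed.

Let N_gt0 : 0 < (2 * n)%:R :> R.
Proof. by rewrite ltr0n; lia. Qed.

Lemma level_rho_gt0 a k : (0 < level a k rho) = (0 < height a k).
Proof. by rewrite -(ltr0z R) -level_rho pmulr_rgt0. Qed.

Lemma level_rho_lt0 a k : (level a k rho < 0) = (height a k < 0).
Proof. by rewrite -(ltrz0 R) -level_rho pmulr_rlt0. Qed.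

Lemma level_rho_neq0 a k : level a k rho != 0.
Proof.
by have := height_neq0 a k; rewrite !neq_lt level_rho_lt0 level_rho_gt0.
Qed.

Lemma rho_alcove : base_alcove rho.
Proof.
have e0 a : pairing a rho = level a 0 rho by rewrite /level subr0.
split=> a; last first.
  case/andP => /eqP h1 /eqP h2; rewrite -subr_lt0 -[_ - 1]/(level a 1 rho).
  by rewrite level_rho_lt0 /height h1 h2; lia.
by case/andP => h1 /eqP h2; rewrite e0 level_rho_gt0 /height h2; lia.
Qed.

Lemma alcove_step x (i j : 'I_(2 * n)) :
  base_alcove x -> j = i.+1 :> nat -> crd x j < crd x i.
Proof.
move=> [h _] e; have [ilt|ige] := ltnP i n.
  have ij : (i, j).1 != (i, j).2 by rewrite eq_ordE /=; lia.
  have := h (Sub (i, j) ij); rewrite /simple_root /= ilt e eqxx => /(_ isT).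
  by rewrite subr_gt0.
(* Past the middle, the same difference is the value of the simple root with the
   dual indices. *)
have ij : (rev_ord j, rev_ord i).1 != (rev_ord j, rev_ord i).2.
  by rewrite eq_ordE /=; have := ltn_ord i; have := ltn_ord j; lia.
have := h (Sub (rev_ord j, rev_ord i) ij); rewrite /simple_root /pairing /=.
have -> : (2 * n - j.+1 < n)%N && (2 * n - i.+1 == (2 * n - j.+1).+1)%N.
  by have := ltn_ord i; have := ltn_ord j; lia.
by move=> /(_ isT); have := crd_rev x i j; lra.
Qed.

Lemma alcove_decr x (i j : 'I_(2 * n)) :
  base_alcove x -> (i < j)%N -> crd x j < crd x i.
Proof.
move=> hx; have [d] := ubnP (j - i)%N; elim: d j => // d IH j hd ij.
have hj : (j.-1 < 2 * n)%N by have := ltn_ord j; lia.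
have h1 := @alcove_step x (Ordinal hj) j hx.
have [e|ne] := eqVneq (j.-1) i.
  by have <- : Ordinal hj = i by [apply: val_inj]; apply: h1 => /=; lia.
have := IH (Ordinal hj); rewrite /= => /(_ _ _) h2.
by apply: (lt_trans (h1 _)) => /=; [lia|apply: h2; lia].
Qed.

Lemma alcove_width x (i j : 'I_(2 * n)) : base_alcove x ->
  crd x i - crd x j < 1.
Proof.
move=> hx; have hN : (0 < 2 * n)%N by lia.
have hN' : ((2 * n).-1 < 2 * n)%N by lia.
pose o := Ordinal hN; pose z := Ordinal hN'.
have oz : (o, z).1 != (o, z).2 by rewrite eq_ordE /=; lia.
have := hx.2 (Sub (o, z) oz); rewrite /highest_root /pairing /= !eqxx.
move=> /(_ isT); apply: le_lt_trans; apply: lerB.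
  have [->//|ne] := eqVneq i o; apply: ltW; apply: alcove_decr => //=.
  by move: ne; rewrite eq_ordE /=; lia.
have [->//|ne] := eqVneq j z; apply: ltW; apply: alcove_decr => //=.
by move: ne; rewrite eq_ordE /=; have := ltn_ord j; lia.
Qed.

(** On the base alcove the coordinates decrease strictly and by less than 1 in
    all, so that no hyperplane meets it: the sign at rho is the sign on the
    whole alcove. *)
Lemma level_alcove_gt0 a k x :
  base_alcove x -> 0 < level a k rho -> 0 < level a k x.
Proof.
move=> hx; rewrite level_rho_gt0 /height /level /pairing.
case: a => -[p q] /=; rewrite eq_ordE => pq h.
have [hp hq] := (ltn_ord p, ltn_ord q).
have hpq := alcove_width p q hx; have hqp := alcove_width q p hx.
have [plt|qlt|/val_inj e] := ltngtP p q; last by rewrite e eqxx in pq.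
- have k0 : k <= 0.
    case: (leP k 0) => // k1.
    have : n%:Z * (2 * 1) <= n%:Z * (2 * k) by apply: ler_mul2n; lia.
    by lia.
  have d := alcove_decr hx plt.
  have : k%:~R <= 0 :> R by rewrite lerz0.
  by lra.
- have k0 : k <= -1.
    case: (leP k (-1)) => // k1.
    have : n%:Z * (2 * 0) <= n%:Z * (2 * k) by apply: ler_mul2n; lia.
    by lia.
  have : k%:~R <= (-1)%:~R :> R by rewrite ler_int.
  by rewrite rmorphN /=; lra.
Qed.

Lemma level_alcove_lt0 a k x :
  base_alcove x -> level a k rho < 0 -> level a k x < 0.
Proof.
by move=> hx; rewrite -!oppr_gt0 -!level_opp; apply: level_alcove_gt0.
Qed.

Lemma level_closure_ge0 a k x :
  closed_base_alcove x -> 0 < level a k rho -> 0 <= level a k x.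
Proof.
move=> hx h.
pose f (v : 'rV[R]_(2 * n)) := v 0 (val a).1 - v 0 (val a).2 - k%:~R.
have cf : continuous f.
  move=> v; exact: (cvgB (cvgB (@coord_continuous _ _ _ 0 _ v)
    (@coord_continuous _ _ _ 0 _ v)) (cvg_cst _)).
suff : closure (@gspval R n @` @base_alcove R n) `<=` f @^-1` [set r | 0 <= r].
  exact.
rewrite closureE; apply: smallest_sub; last first.
  by move=> _ [y hy <-]; apply: ltW; apply: (level_alcove_gt0 hy h).
apply: closed_comp => [? _|]; [exact: cf|exact: closed_ge].
Qed.

End BaseAlcove.

(** * Words in a set of transformations *)

Section Words.
Variable T : Type.
Implicit Types (S : set (T -> T)) (u v w : T -> T).

Lemma word_cat S i j u v :
  is_word S i u -> is_word S j v -> is_word S (i + j) (u \o v).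
Proof.
by elim=> // i' s w hs _ IH hv; rewrite addSn; apply: is_wordS hs (IH hv).
Qed.

Lemma word1 S u : S u -> is_word S 1 u.
Proof. by move=> hu; apply: is_wordS hu (is_word0 _). Qed.

Lemma generated1 S u : S u -> generated S u.
Proof. by exists 1%N; apply: word1. Qed.

Lemma generated_comp S u v :
  generated S u -> generated S v -> generated S (u \o v).
Proof. by move=> [i hu] [j hv]; exists (i + j)%N; apply: word_cat. Qed.

Lemma generated_sub S S' w :
  (forall u, S u -> generated S' u) -> generated S w -> generated S' w.
Proof.
move=> sub [j]; elim=> {j w} [|j u w hu _ hw]; first by exists 0%N; constructor.
by apply: generated_comp hw; apply: sub.
Qed.

Lemma has_length_exists S w : generated S w -> exists j, has_length S w j.
Proof.
move=> [j hj]; have ex : exists j, `[< is_word S j w >] by exists j;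
  apply/asboolP.
have [i /asboolP hi min] := ex_minnP ex.
by exists i; split=> // m /asboolP; apply: min.
Qed.

End Words.

(** * The exchange condition and the Bruhat order *)

Section BruhatOrder.
Variables (R : realType) (n : nat).
Hypothesis n_gt0 : (0 < n)%N.
Local Notation V := (gspvec R n).
Local Notation rho := (@rho R n n_gt0).
Local Notation refl a k := (@affine_reflection R n a k).
Local Notation S := (@Saff R n).
Implicit Types (a b : gsp_root n) (k m : int) (x y : V) (l : coweight n)
  (s t : weyl n) (w : V -> V).

Definition simple_affine b m : bool :=
  simple_root b && (m == 0) || highest_root b && (m == 1).

Lemma SaffP w :
  S w <-> exists b m, simple_affine b m /\ w = refl b m.
Proof.
split=> [[] [b [hb ->]]|[b [m [/orP[]/andP[hb /eqP ->] ->]]]].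
- by exists b, 0; rewrite /simple_affine hb.
- by exists b, 1; rewrite /simple_affine hb orbT.
- by left; exists b.
- by right; exists b.
Qed.

Fact dual_root_subproof a :
  (rev_ord (val a).2, rev_ord (val a).1).1
    != (rev_ord (val a).2, rev_ord (val a).1).2.
Proof. by rewrite /= (inj_eq rev_ord_inj) eq_sym (valP a). Qed.

Definition dual_root a : gsp_root n := Sub (_, _) (dual_root_subproof a).

Lemma level_dual a k x : level (dual_root a) k x = level a k x.
Proof.
rewrite /level /pairing /=.
by have := crd_rev x (val a).1 (val a).2; lra.
Qed.

Lemma reflection_dual a k : refl (dual_root a) k = refl a k.
Proof.
apply/funext => x; rewrite !affine_reflectionE level_dual.
congr (_ - _ *: _); apply: gspvec_eq => i.
rewrite !(crd_coroot_int R) !coroot_coef /= !rev_ordK.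
by rewrite (orbC (i == rev_ord _)) (orbC (i == rev_ord (val a).1)).
Qed.

Lemma coroot_diff2 b (i j : 'I_(2 * n)) :
  crd (coroot int b) i - crd (coroot int b) j = 2 ->
  (i = (val b).1 \/ i = rev_ord (val b).2)
  /\ (j = (val b).2 \/ j = rev_ord (val b).1).
Proof.
rewrite !coroot_coef; case: ifP => [/orP hi|_].
  case: ifP => [_|_] //; case: ifP => [/orP hj _|//].
  by split; [case: hi|case: hj] => /eqP ->; [left|right|left|right].
by do 3?[case: ifP => _].
Qed.

Lemma reflection_eq a b k :
  (val a).1 = (val b).1 :> nat /\ (val a).2 = (val b).2 :> nat
  \/ (val a).1 = rev_ord (val b).2 :> nat
    /\ (val a).2 = rev_ord (val b).1 :> nat ->
  refl a k = refl b k.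
Proof.
move=> [] [/val_inj e1 /val_inj e2].
  have -> : a = b by apply: val_inj;
    rewrite [LHS]surjective_pairing e1 e2 -surjective_pairing.
  by [].
rewrite -reflection_dual; have -> : dual_root a = b; last by [].
by apply: val_inj; rewrite /= e1 e2 !rev_ordK -surjective_pairing.
Qed.

(** A simple reflection changes the sign at rho of no affine root but its own
    and the opposite one. Indeed it subtracts height b m * <a, b^v> from the
    height of (a, k); heights are nonzero integers, those of the simple affine
    roots are 1 or -1, and the pairing is at most 2 in absolute value. Hence a
    positive height can only become negative if it is 1 and the pairing is twice
    height b m, which leaves the simple root itself up to sign. *)
Lemma simple_exchange b m a k :
  simple_affine b m -> level a k rho * level a k (refl b m rho) < 0 ->
  refl a k = refl b m.
Proof.
move=> hb; wlog pos : a k / 0 < level a k rho => [wl h|].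
  have [p|p] := ltP 0 (level a k rho); first exact: wl.
  rewrite -reflection_opp; apply: wl.
    by rewrite level_opp oppr_gt0 lt_neqAle level_rho_neq0.
  by rewrite !level_opp mulrNN.
rewrite pmulr_rlt0 // level_reflection => h.
have {pos} pos : 0 < height a k by rewrite -(level_rho_gt0 R n_gt0).
have {h} : (height a k - height b m * pairing a (coroot int b) < 0).
  rewrite -(ltrz0 R) rmorphB rmorphM /= -!(level_rho R n_gt0) -mulrA -mulrBr.
  by rewrite pmulr_rlt0 // ltr0n; lia.
have hb1 : height b m = 1 \/ height b m = -1.
  move: hb; rewrite /height => /orP[]/andP[/andP[h1 /eqP h2] /eqP ->]; lia.
have hc : `|pairing a (coroot int b)| <= 2.
  by rewrite /pairing !coroot_coef; do 4?[case: ifP => _].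
move=> neg; have [ha hc2] : height a k = 1
    /\ pairing a (coroot int b) = 2 * height b m.
  by case: hb1 => e; move: neg; rewrite e; lia.
have {pos neg hb1 hc} k0 : k = 0 \/ k = -1.
  have [pN qN] := (ltn_ord (val a).1, ltn_ord (val a).2).
  have [k0|[/(ler_mul2n n) k1|/(ler_mul2n n) k1]] : (k = 0 \/ k
    = -1) \/ (1 <= k \/ k <= -2).
  - by lia.
  - by [].
  - by move: ha; rewrite /height; lia.
  - by move: ha; rewrite /height; lia.
have [pN qN] := (ltn_ord (val b).1, ltn_ord (val b).2).
move: hb ha hc2 => /orP[]/andP[/andP[hb1 /eqP hb2] /eqP m0]; rewrite /height m0.
  rewrite hb2 => ha hc2.
  have [hp hq] : ((val a).1 = (val b).1 \/ (val a).1 = rev_ord (val b).2)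
      /\ ((val a).2 = (val b).2 \/ (val a).2 = rev_ord (val b).1).
    by apply: coroot_diff2; rewrite -[LHS]/(pairing a _) hc2; lia.
  have [-> e] : k = 0 /\ ((val a).1 = (val b).1 :> nat
    /\ (val a).2 = (val b).2 :> nat
      \/ (val a).1 = rev_ord (val b).2 :> nat
        /\ (val a).2 = rev_ord (val b).1 :> nat).
    clear hc2 m0; move: (val b) hb1 hb2 pN qN hp hq ha =>
      [b1 b2] /= hb1 hb2 pN qN.
    case: k0 => -> hp hq ha; case: hp ha => ->; case: hq => -> /= ha; lia.
  exact: reflection_eq.
rewrite (eqP hb1) hb2 => ha hc2.
have [hq hp] : ((val a).2 = (val b).1 \/ (val a).2 = rev_ord (val b).2)
    /\ ((val a).1 = (val b).2 \/ (val a).1 = rev_ord (val b).1).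
  apply: coroot_diff2; move: hc2; rewrite /pairing; lia.
have [-> e] : k = -1 /\ ((val a).2 = (val b).1 :> nat
  /\ (val a).1 = (val b).2 :> nat).
  move: (eqP hb1) => {}hb1; clear hc2 m0.
  move: (val b) hb1 hb2 pN qN hp hq ha => [b1 b2] /= hb1 hb2 pN qN.
  case: k0 => -> hp hq ha; case: hp ha => ->; case: hq => -> /= ha; lia.
rewrite -reflection_opp; apply: reflection_eq; left; exact: e.
Qed.

(** The factor height b m is 1 or -1 and makes the simple affine root positive
    on the alcove. For a = (p, q) the coroot of b is to be larger at p than at
    q; for most a some finite simple root does it, and the affine simple
    reflection takes care of the others. *)
Lemma simple_descent a :
  exists b m, simple_affine b m /\ 0 < height b m * pairing a (coroot int b).
Proof.
have simple i (ilt : (i < n)%N) : exists b, [/\ simple_affine b 0, height b 0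
  = 1,
    (val b).1 = i :> nat & (val b).2 = i.+1 :> nat].
  have h1 : (i < 2 * n)%N by lia.
  have h2 : (i.+1 < 2 * n)%N by lia.
  have h : (Ordinal h1, Ordinal h2).1 != (Ordinal h1, Ordinal h2).2.
    by rewrite eq_ordE /=; lia.
  exists (Sub (_, _) h); split=> //; last by rewrite /height /=; lia.
  by rewrite /simple_affine /simple_root /= ilt !eqxx.
have [N1 N2] : (0 < 2 * n)%N /\ ((2 * n).-1 < 2 * n)%N by lia.
have h : (Ordinal N1, Ordinal N2).1 != (Ordinal N1, Ordinal N2).2.
  by rewrite eq_ordE /=; lia.
pose b0 : gsp_root n := Sub (_, _) h.
rewrite /pairing; move: (valP a) (ltn_ord (val a).1) (ltn_ord (val a).2).
move: (val a) => [p q] /=; rewrite eq_ordE => pq pN qN.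
(* A coroot equal to 1 at p, but not at q. *)
have [hA|hA] := boolP ((p < (2 * n).-1)%N && (q != 2 * n - 2 - p :> nat)%N).
  have [|b [hb hh e1 e2]] :=
    simple (if p < n then nat_of_ord p else 2 * n - 2 - p)%N.
    by case: ifP; lia.
  exists b, 0; split=> //; rewrite hh mul1r !coroot_coef !eq_ordE /= e1 e2.
  set i := (if (p < n)%N then _ else _).
  have [ip ip'] : (i = p \/ i = 2 * n - 2 - p)%N /\ (i < n)%N.
    by rewrite /i; case: ifP => /=; lia.
  have -> : ((p == i :> nat) || (p == 2 * n - i.+2 :> nat))%N by lia.
  have -> : ((q == i :> nat) || (q == 2 * n - i.+2 :> nat))%N = false by lia.
  by case: ifP.
(* A coroot equal to -1 at q, but not at p. *)
have [hB|hB] := boolP ((0 < q)%N && (p != 2 * n - q :> nat)%N).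
  have [|b [hb hh e1 e2]] := simple (if q <= n then q.-1 else 2 * n - 1 - q)%N.
    by case: ifP; lia.
  exists b, 0; split=> //; rewrite hh mul1r !coroot_coef !eq_ordE /= e1 e2.
  set i := (if (q <= n)%N then _ else _).
  have [iq iq'] : (i = q.-1 \/ i = 2 * n - 1 - q)%N /\ (i < n)%N.
    by rewrite /i; case: ifP => /=; lia.
  have -> : ((q == i :> nat) || (q == 2 * n - i.+2 :> nat))%N = false by lia.
  have -> : ((q == i.+1 :> nat) || (q == 2 * n - i.+1 :> nat))%N by lia.
  have -> : ((p == i.+1 :> nat) || (p == 2 * n - i.+1 :> nat))%N = false by lia.
  by case: ifP.
(* There remain p = 2n-1 with q at most 1, and p = 2n-2 with q = 0. *)
exists b0, 1; split; first
  by rewrite /simple_affine /highest_root /= !eqxx orbT.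
have -> : height b0 1 = -1 by rewrite /height /=; lia.
rewrite !coroot_coef !eq_ordE /=.
by do 4?[case: ifP => ?]; lia.
Qed.

Lemma height_reflection b m a k l s :
  refl b m = affine l s ->
  height (weyl_root s a) (k - crd l (val a).1 + crd l (val a).2)
  = height a k - height b m * pairing a (coroot int b).
Proof.
move=> e; apply: (@intr_inj R); rewrite [RHS]rmorphB [X in _ = _ - X]rmorphM /=.
rewrite -!(level_rho R n_gt0).
by rewrite -level_affine -e level_reflection -mulrA -mulrBr.
Qed.

Lemma level_alcove_rho a k x :
  base_alcove x -> 0 < level a k rho * level a k x.
Proof.
move=> hx; have := level_rho_neq0 R n_gt0 a k; rewrite neq_lt => /orP[] h.
  by rewrite nmulr_rgt0 //; apply: (level_alcove_lt0 hx h).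
by apply: mulr_gt0 => //; apply: (level_alcove_gt0 hx h).
Qed.

Lemma word_affine i w : is_word S i w -> exists l s, w = affine l s.
Proof.
elim=> [|i' u w' /SaffP[b [m [_ ->]]] _ [l [s ->]]].
  by exists 0, (weyl1 n); apply/funext => x; rewrite affine0 weyl_act1.
by rewrite reflection_is_affine affineM; do 2!eexists.
Qed.

Lemma Saff_invol u : S u -> involutive u.
Proof. by move=> /SaffP[b [m [_ ->]]]; apply: affine_reflectionK. Qed.

(** The word is a gallery from the base alcove A to w A, which crosses every
    hyperplane H separating the two; deleting the letter of a crossing yields
    s_H w. The induction strips the first letter u: if H separates A from u A
    then s_H = u, and otherwise H is replaced by u H. *)
Lemma strong_exchange j w a k :
  is_word S j w -> level a k rho * level a k (w rho) < 0 ->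
  exists2 j', j = j'.+1 & is_word S j' (refl a k \o w).
Proof.
move=> hw; elim: hw a k => {j w} [a k|j u w hs hw IH a k].
  by rewrite -expr2 ltNge sqr_ge0.
have [b [m [hb e]]] := (SaffP u).1 hs.
have := reflection_is_affine R b m; move: (_ *: _) (refl_weyl b) => l s es h.
have [h0|h0] := ltP (level a k rho * level a k (u rho)) 0.
  exists j => //; rewrite (simple_exchange hb) -?e //.
  by rewrite compA (_ : u \o u = idfun) //; apply/funext => x;
    apply: Saff_invol.
have ew x : level a k (u x)
    = level (weyl_root s a) (k - crd l (val a).1 + crd l (val a).2) x.
  by rewrite e es level_affine.
have [|j' -> hj'] := IH (weyl_root s a) (k - crd l (val a).1 + crd l (val a).2).
  have p : 0 < level a k rho * level a k (u rho).
    by rewrite lt_neqAle h0 eq_sym mulf_neq0 // ?ew level_rho_neq0.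
  rewrite -!ew; move: h p => /=.
  have := level_rho_neq0 R n_gt0 a k; rewrite neq_lt => /orP[] h1.
    by rewrite nmulr_rlt0 // nmulr_rgt0 // => ? ?; rewrite nmulr_rlt0.
  by rewrite pmulr_rlt0 // pmulr_rgt0 // => ? ?; rewrite pmulr_rlt0.
exists j'.+1 => //; rewrite compA e es reflection_affine -compA -es -e.
exact: is_wordS.
Qed.

(** A positive affine root that is not simple stays positive and loses height
    under a well-chosen simple reflection, by [simple_descent] and
    [simple_exchange]; so its hyperplane can be moved to a wall of the base
    alcove. *)
Lemma reflection_conjugate a k : conjugate_of_generator S (refl a k).
Proof.
wlog pos : a k / 0 < height a k => [wl|].
  have [p|p|/eqP] := ltgtP 0 (height a k); first exact: wl.
  - rewrite -reflection_opp; apply: wl.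
    by rewrite -(level_rho_gt0 R n_gt0) level_opp oppr_gt0 level_rho_lt0.
  - by rewrite eq_sym (negbTE (height_neq0 a k)).
have [h] : exists h : nat, height a k = h%:Z by exists `|height a k|%N; lia.
elim/ltn_ind: h => h IH in a k pos *; move=> hE.
have [b [m [hb hdesc]]] := simple_descent a.
have Sb : S (refl b m) by apply/SaffP; exists b, m.
have e := reflection_is_affine R b m.
have hh := height_reflection a k e.
have ec := @reflection_affine R n a k (m *: coroot int b) (refl_weyl b).
rewrite -e in ec; move: hh ec; set a' := weyl_root _ _;
  set k' := _ + _ => hh ec.
have [neg|p|/eqP] := ltgtP 0 (height a' k'); last first.
- by rewrite eq_sym (negbTE (height_neq0 _ _)).
- exists idfun, idfun, (refl b m); split=> //; first by exists 0%N; constructor.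
  apply: simple_exchange hb _.
  by rewrite pmulr_rlt0 ?level_rho_gt0 // e level_affine -/a' -/k'
    level_rho_lt0.
have [||w [w' [u [hw ww' w'w hu et]]]] := IH `|height a' k'|%N _ a' k' neg.
- by lia.
- by lia.
have inv := @affine_reflectionK R n b m.
exists (refl b m \o w), (w' \o refl b m), u; split=> //.
- by apply: generated_comp hw; apply: generated1 Sb.
- by move=> x /=; rewrite inv ww'.
- by move=> x /=; rewrite w'w inv.
apply/funext => x; have := congr1 (@^~ (refl b m x)) ec.
by rewrite /= inv et.
Qed.

Lemma conjugate_is_reflection (t : V -> V) :
  conjugate_of_generator S t -> exists a k, t = refl a k.
Proof.
move=> [w [w' [u [[j /word_affine [l [s ew]]] _ w'w /SaffP[b [m [_ eu]]] ->]]]].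
have ab : (val s (val b).1, val s (val b).2).1 != (val s (val b).1, val s (val
  b).2).2.
  by rewrite /= (inj_eq perm_inj) (valP b).
pose a : gsp_root n := Sub (_, _) ab.
exists a, (m + crd l (val a).1 - crd l (val a).2).
have eb : weyl_root s a = b.
  by apply: val_inj; rewrite /= !permK -surjective_pairing.
have := @reflection_affine R n a (m + crd l (val a).1 - crd l (val a).2) l s.
rewrite eb; move: (crd l (val a).1) (crd l (val a).2) => X Y.
have -> : m + X - Y - X + Y = m by ring.
rewrite -ew -eu => <-.
by rewrite -compA; apply/funext => x /=; rewrite w'w.
Qed.

Lemma reflection_generated a k : generated S (refl a k).
Proof.
have [w [w' [u [hw ww' w'w hu ->]]]] := reflection_conjugate a k.
apply: generated_comp; first by apply: generated_comp hw (generated1 hu).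
(* The inverse of a word is the word read backwards. *)
have [j {}hw] := hw; exists j.
elim: hw w' ww' w'w => [w' _ /(_ _) h|i v w0 hv hw0 IH w' ww' w'w].
  by rewrite (_ : w' = idfun); [constructor|apply/funext => x; apply: h].
have inv := Saff_invol hv.
have -> : w' = (w' \o v) \o v by apply/funext => x /=; rewrite inv.
rewrite -addn1; apply: word_cat (word1 hv); apply: IH => x /=.
  by apply: ww'.
by apply: (can_inj inv); apply: w'w.
Qed.

(** If H does not separate A from w A, then it separates A from s_H w A, and the
    exchange condition shortens a reduced word of s_H w to a word of w. *)
Lemma bruhat_step_up a k w :
  generated S w -> 0 < level a k rho * level a k (w rho) ->
  bruhat_step S w (refl a k \o w).
Proof.
move=> hw pos.
have hrw := generated_comp (reflection_generated a k) hw.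
have [i hi] := has_length_exists hw; have [j hj] := has_length_exists hrw.
exists (refl a k), i, j; split=> //; first exact: reflection_conjugate.
have [|i' -> hi'] := strong_exchange (a := a) (k := k) hj.1.
  by rewrite /= level_reflectionxx mulrN oppr_lt0.
rewrite ltnS; apply: hi.2; move: hi'; rewrite compA.
by rewrite (_ : refl a k \o refl a k = idfun) //; apply/funext => x;
  apply: affine_reflectionK.
Qed.

(** If H separated A from u A, then s_H u would be shorter than u. *)
Lemma bruhat_step_inv u v :
  bruhat_step S u v ->
  exists a k, [/\ v = refl a k \o u, generated S u
                & 0 < level a k rho * level a k (u rho)].
Proof.
move=> [t [i [j [ht -> hi hj ij]]]].
have [a [k et]] := conjugate_is_reflection ht; exists a, k; rewrite et in hj *.
split=> //; first by exists i; case: hi.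
have [l [s eu]] := word_affine hi.1.
rewrite lt_neqAle eq_sym mulf_neq0 ?eu ?level_affine ?level_rho_neq0 //=.
rewrite leNgt -level_affine -eu; apply/negP => neg.
have [i' e /hj.2] := strong_exchange hi.1 neg; lia.
Qed.

End BruhatOrder.

(** * Vertices of the base alcove and permissibility *)

(** The shape of the sums of dominant minuscule coweights, see [block_sum]. *)
Definition block n (A B : int) (mu : coweight n) : Prop :=
  A <= B /\ forall i, crd mu i = if (i < n)%N then B else A.

Lemma block_orbit n A B (mu : coweight n) (s : weyl n) i :
  block A B mu ->
  let v j := crd (weyl_act s mu) j in
  [/\ A <= v i, v i <= B & v i + v (rev_ord i) = A + B].
Proof.
move=> [AB h] v; rewrite /v !crd_weyl weylV_rev !h.
case: ((val s)^-1%g i) => j hj /=.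
by split; do ?[case: ifP => ?]; lia.
Qed.

Section Vertices.
Variables (R : realType) (n : nat).
Hypothesis n_gt0 : (0 < n)%N.
Local Notation V := (gspvec R n).
Local Notation rho := (@rho R n n_gt0).
Implicit Types (a b : gsp_root n) (k m : int) (x y : V).

(** The points x + t (rho - x) with 0 < t <= 1 lie in the base alcove and tend
    to x. *)
Lemma closed_alcoveP x :
  (forall a, simple_root a -> 0 <= pairing a x) ->
  (forall a, highest_root a -> pairing a x <= 1) ->
  closed_base_alcove x.
Proof.
move=> h1 h2 B xB.
pose f (t : R) : 'rV[R]_(2 * n) := gspval x + t *: gspval (rho - x).
have cf : f t @[t --> 0^'+] --> gspval x.
  apply: cvg_at_right_filter;
    rewrite -[X in _ --> X]addr0 -(scale0r (gspval (rho - x))).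
  apply: cvgD; first exact: cvg_cst.
  by apply: cvgZr_tmp; apply: cvg_id.
have [t [[t0 t1] Bt]] : exists t : R, (0 < t /\ t <= 1) /\ B (f t).
  apply: (@filter_ex _ (0^'+ : set_system R)); near=> t; split; last first.
    by near: t; apply: cf.
  by split; near: t; [exact: nbhs_right_gt | exact: nbhs_right_le].
exists (f t); split=> //; exists (x + t *: (rho - x)); last first.
  by apply/rowP => i; rewrite crdD crdZ !mxE.
have [r1 r2] := rho_alcove R n_gt0.
have e a : pairing a (x + t *: (rho - x))
  = (1 - t) * pairing a x + t * pairing a rho.
  by rewrite /pairing !crdD !crdZ !crdB; ring.
by split=> a ha; rewrite e; [have := h1 a ha;
  have := r1 a ha | have := h2 a ha; have := r2 a ha]; nra.
Unshelve. all: by end_near.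
Qed.

Fact ones_subproof : const_mx 1 \in @gsp_pred R n.
Proof. by apply/gsp_predP => i j; rewrite !mxE. Qed.

(** The direction of the minimal facets. *)
Definition ones : V := GspVec ones_subproof.

Lemma facet_ones x y : facet x y -> facet x (y + ones).
Proof.
move=> h a k; rewrite -h /pairing !crdD [crd ones _]mxE [crd ones _]mxE.
by congr (Num.sg _); ring.
Qed.

Lemma ones_diff x : const_mx 1 = gspval (x + ones) - gspval x :> 'rV[R]_(2 * n).
Proof. by apply/rowP => i; rewrite !mxE; ring. Qed.

Lemma has_dim_facet_gt0 x d : has_dim (facet x) d -> (0 < d)%N.
Proof.
move=> [U [<- hU _]].
have : const_mx 1 \in U.
  rewrite (ones_diff x).
  by apply: hU; [apply: facet_ones|].
rewrite memvE => /dimvS; apply: leq_trans; rewrite dim_vline lt0b.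
have N_gt0 : (0 < 2 * n)%N by lia.
apply/eqP => /rowP /(_ (Ordinal N_gt0)); rewrite !mxE; lra.
Qed.

(** The long roots take integral values at x, hence are constant on the facet of
    x. As dual coordinates have a constant sum, twice the difference of any two
    coordinates is a difference of values of long roots, so it is constant on
    the facet as well, which is therefore a line. *)
Lemma vertex_of_integral x :
  closed_base_alcove x ->
  (forall p, exists z : int, crd x p - crd x (rev_ord p) = z%:~R) -> vertex x.
Proof.
move=> cx hx; split=> //; exists 1%N; split; last first.
  by move=> y e _; apply: has_dim_facet_gt0.
have N_gt0 : (0 < 2 * n)%N by lia.
have rig y p q : facet x y -> crd y p - crd y q = crd x p - crd x q.
  move=> h; have long r : crd y r - crd y (rev_ord r)
    = crd x r - crd x (rev_ord r).
    have [z hz] := hx r.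
    have rr : (r, rev_ord r).1 != (r, rev_ord r).2 by rewrite /= rev_ord_neq.
    have := h (Sub (r, rev_ord r) rr) z; rewrite /pairing /= hz subrr sgr0.
    by move=> /eqP; rewrite sgr_eq0 subr_eq0 => /eqP.
  have := (long p, long q, crd_rev y p q, crd_rev x p q) => -[[[]]]; lra.
exists <[const_mx 1]>%VS; split.
- rewrite dim_vline; apply/eqP; rewrite eqb1.
  by apply/eqP => /rowP /(_ (Ordinal N_gt0)); rewrite !mxE; lra.
- move=> y y' hy hy'; apply/vlineP.
  exists (crd y (Ordinal N_gt0) - crd y' (Ordinal N_gt0)); apply/rowP => i.
  rewrite !mxE mulr1; have := rig y i (Ordinal N_gt0) hy.
  by have := rig y' i (Ordinal N_gt0) hy'; lra.
- move=> U' hU'; rewrite -memvE.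
  rewrite (ones_diff x).
  by apply: hU'; [apply: facet_ones|].
Qed.

Lemma eta_rev (i j : 'I_(2 * n)) : ((j < i) + (j < 2 * n - i))%N%:R / 2
   + ((rev_ord j < i) + (rev_ord j < 2 * n - i))%N%:R / 2 = 1 :> R.
Proof.
rewrite -mulrDl -natrD; have -> : ((j < i) + (j < 2 * n - i)
    + ((rev_ord j < i) + (rev_ord j < 2 * n - i)))%N = 2%N.
  by have := ltn_ord i; have := ltn_ord j; rewrite /=; lia.
by rewrite mulfV // pnatr_eq0.
Qed.

Fact eta_subproof (i : 'I_(2 * n)) :
  \row_(j < 2 * n) (((j < i) + (j < 2 * n - i))%N%:R / 2) \in @gsp_pred R n.
Proof. by apply/gsp_predP => j k; rewrite !mxE !eta_rev. Qed.

(** The points (omega_i + omega_(2n-i)) / 2, where omega_i starts with i ones;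
    the index 0 yields the vertex 0 up to the centre, and i and 2n - i yield the
    same vertex. *)
Definition eta i : V := GspVec (eta_subproof i).

Lemma crd_eta i j : crd (eta i) j = ((j < i) + (j < 2 * n - i))%N%:R / 2.
Proof. by rewrite mxE. Qed.

Lemma vertex_eta i : vertex (eta i).
Proof.
have half (u v : nat) : (u <= v)%N -> u%:R / 2 <= v%:R / 2 :> R.
  by move=> uv; rewrite ler_pM2r ?invr_gt0 // ler_nat.
apply: vertex_of_integral => [|p].
  apply: closed_alcoveP => a.
    move=> /andP[h1 /eqP h2]; rewrite /pairing subr_ge0 !crd_eta; apply: half.
    by rewrite h2; lia.
  move=> _; rewrite /pairing !crd_eta lerBlDr.
  set u := (X in X%:R / 2 <= _); set v := (X in _ <= _ + X%:R / 2).
  have uv : (u <= 2 + v)%N by rewrite /u; lia.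
  by have := half _ _ uv; rewrite natrD; lra.
exists (((p < i) + (p < 2 * n - i))%N%:Z - 1).
have := eta_rev i p; rewrite !crd_eta rmorphB /= -pmulrn; lra.
Qed.

Lemma sum_ltn (j M : nat) : (\sum_(i < M) (j < i) = M - j.+1)%N.
Proof. by elim: M => [|M IH]; rewrite ?big_ord0 // big_ord_recr /= IH; lia. Qed.

Lemma sum_ltn_sub (j M : nat) : (\sum_(i < M) (j < M - i) = M - j)%N.
Proof.
rewrite (reindex_inj rev_ord_inj) /=.
rewrite (eq_bigr (fun i : 'I_M => (j <= i)%N : nat)); last first.
  by move=> i _; rewrite subKn.
by elim: M => [|M IH]; rewrite ?big_ord0 // big_ord_recr /= IH; lia.
Qed.

Lemma rho_mean j : (2 * n)%:R * crd rho j = \sum_i crd (eta i) j.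
Proof.
rewrite crd_rho (eq_bigr _ (fun i _ => crd_eta i j)) -mulr_suml -natr_sum.
rewrite big_split /= sum_ltn sum_ltn_sub natrD !natrB ?(ltnW (ltn_ord j)) //.
by rewrite -natr1; field.
Qed.

Definition in_box (A B : int) x : Prop :=
  forall i, [/\ A%:~R <= crd x i, crd x i <= B%:~R
              & crd x i + crd x (rev_ord i) = (A + B)%:~R].

Lemma crd_combination (c : weyl n -> R) (mu : coweight n) i :
  crd (\sum_s c s *: gsp_real R (weyl_act s mu)) i
  = \sum_s c s * (crd (weyl_act s mu) i)%:~R.
Proof.
have scale (r : R) (l : coweight n) :
    crd (r *: gsp_real R l) i = r * (crd l i)%:~R by rewrite crdZ crd_real.
by rewrite crd_sum; apply: eq_bigr => s _; apply: scale.
Qed.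

Lemma Conv_box A B mu x : block A B mu -> Conv mu x -> in_box A B x.
Proof.
move=> hmu [c [c0 c1 ->]] i.
have hb s := block_orbit s i hmu.
have e (z : R) : z = \sum_s c s * z by rewrite -mulr_suml c1 mul1r.
rewrite !crd_combination; split.
- rewrite [X in X <= _]e; apply: ler_sum => s _.
  by rewrite ler_wpM2l // ler_int; case: (hb s).
- rewrite [X in _ <= X]e; apply: ler_sum => s _.
  by rewrite ler_wpM2l // ler_int; case: (hb s).
- rewrite -big_split /= [RHS]e; apply: eq_bigr => s _.
  by rewrite -mulrDr -rmorphD /=; case: (hb s) => _ _ ->.
Qed.

(** An affine transformation preserves means, so that x(rho) - rho is the mean
    of the x(eta_i) - eta_i, and the box is convex. *)
Lemma permissible_box A B mu l s :
  block A B mu ->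
  (forall a : V, vertex a -> Conv mu (affine l s a - a)) ->
  in_box A B (affine l s rho - rho).
Proof.
move=> hmu h.
have N0 : 0 < (2 * n)%:R :> R by rewrite ltr0n; lia.
have hb i := Conv_box hmu (h _ (vertex_eta i)).
have mean j : (2 * n)%:R * crd (affine l s rho - rho) j
    = \sum_i crd (affine l s (eta i) - eta i) j.
  rewrite crdB crd_affine mulrBr mulrDr !rho_mean.
  under [RHS]eq_bigr do rewrite crdB crd_affine.
  by rewrite sumrB big_split /= sumr_const card_ord mulr_natl.
have e (z : R) : (2 * n)%:R * z = \sum_(i < 2 * n) z.
  by rewrite sumr_const card_ord mulr_natl.
move=> i; split.
- by rewrite -(ler_pM2l N0) mean e; apply: ler_sum => j _; case: (hb j i).
- by rewrite -(ler_pM2l N0) mean e; apply: ler_sum => j _; case: (hb j i).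
- apply: (mulfI (lt0r_neq0 N0)); rewrite mulrDr !mean e -big_split /=.
  by apply: eq_bigr => j _; case: (hb j i).
Qed.

End Vertices.

(** * Reflecting away from the barycentre inside the box *)

Section Ascent.
Variable n : nat.
Local Notation N := (2 * n)%N.

Lemma ord_not_congruent (i j : 'I_N) (z : int) : i != j ->
  i%:Z - j%:Z != N%:Z * z.
Proof.
move=> ij; have h : (j, i).1 != (j, i).2 by rewrite /= eq_sym.
by have := height_neq0 (Sub (j, i) h : gsp_root n) z; rewrite subr_eq0.
Qed.

(** This is the combinatorial heart of the proof. For x = t_l s, let r be the
    inverse of s and D be 2n (x(rho) - rho). Reflecting in the hyperplane of the
    pair (p, q) at level k exchanges the coordinates p and q of x(rho), shifted
    by k and -k. So the last two conclusions say that the reflected point is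
    still in the box, and the second one says that rho and x(rho) are on the
    same side of the hyperplane.

    If r p differs from p, then q = r p works. Not being divisible by 2n, D q is
    not extreme. The level l p - A makes the new D q equal to 2n A and the new D
    p equal to D p + D q - 2n A, while the level l p - B makes them 2n B and D p
    + D q - 2n B; one of the two choices stays in the box.

    If r p = p, then D p = 2n (l p) with A < l p < B, and the dual q of p works.
    The level k is such that e = q - p - 2n k has the sign of 2 (l p) - A - B,
    or either sign if this is 0, and absolute value less than 2n: the reflection
    changes D p to D q - e and D q to D p + e, whereas D p and D q are at least
    2n away from the extremes. *)
Lemma integral_ascent (A B : int) (l : 'I_N -> int) (r : 'I_N -> 'I_N)
    (D : 'I_N -> int) (p : 'I_N) :
  injective r -> (forall i, r (rev_ord i) = rev_ord (r i)) ->
  (forall i, l i + l (rev_ord i) = A + B) ->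
  (forall i, D i = N%:Z * l i - (r i)%:Z + i%:Z) ->
  (forall i, N%:Z * A <= D i <= N%:Z * B) ->
  D p != N%:Z * A -> D p != N%:Z * B ->
  exists q k, [/\ p != q,
    0 < (q%:Z - p%:Z - N%:Z * k) * ((D p - p%:Z) - (D q - q%:Z) - N%:Z * k),
    N%:Z * A <= D q - q%:Z + p%:Z + N%:Z * k <= N%:Z * B
    & N%:Z * A <= D p - p%:Z + q%:Z - N%:Z * k <= N%:Z * B].
Proof.
move=> rI rrev lrev hD hb pA pB; have hbp := hb p.
have [rp|rp] := eqVneq (r p) p; last first.
  have hbq := hb (r p); have rr : r (r p) != r p by rewrite (inj_eq rI).
  have nonext z : D (r p) != N%:Z * z.
    apply: contra_neq (ord_not_congruent (l (r p) - z) rr).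
    by rewrite hD mulrBr; lia.
  have [qA qB] := (nonext A, nonext B); have hDp := hD p.
  have [le|gt] := leP (D p + D (r p)) (N%:Z * (A + B)).
    exists (r p), (l p - A); rewrite eq_sym; split=> //; rewrite ?(mulrBr N%:Z).
    - by rewrite nmulr_rgt0; lia.
    - by lia.
    - by lia.
  exists (r p), (l p - B); rewrite eq_sym; split=> //; rewrite ?(mulrBr N%:Z).
  - by rewrite pmulr_rgt0; lia.
  - by lia.
  - by lia.
have hDp := hD p; have hDq := hD (rev_ord p); rewrite rrev rp in hDq hDp.
have pN := ltn_ord p; have N0 : 0 < N%:Z by lia.
have {}hDp : D p = N%:Z * l p by lia.
move: pA pB hbp; rewrite hDp !(inj_eq (mulfI (lt0r_neq0 N0))) !ler_pM2l // =>
  pA pB /andP[lA lB].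
have hA : N%:Z * (A + 1) <= N%:Z * l p by rewrite ler_pM2l //; lia.
have hB : N%:Z * l p <= N%:Z * (B - 1) by rewrite ler_pM2l //; lia.
have lq : l (rev_ord p) = A + B - l p by have := lrev p; lia.
rewrite lq !mulrDr mulrN /= in hDq; rewrite !mulrDr in hA hB.
have pq : p != rev_ord p by rewrite rev_ord_neq.
have [ge|lt] := leP (N%:Z * A + N%:Z * B) (2 * (N%:Z * l p)).
  exists (rev_ord p), (if (p < n)%N then 0 else -1); split=> //.
  - by rewrite pmulr_rgt0 /=; case: ifP => h; rewrite ?mulr0 ?mulrN1; lia.
  - by rewrite /=; case: ifP => h; rewrite ?mulr0 ?mulrN1; lia.
  - by rewrite /=; case: ifP => h; rewrite ?mulr0 ?mulrN1; lia.
exists (rev_ord p), (if (p < n)%N then 1 else 0); split=> //.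
- by rewrite nmulr_rgt0 /=; case: ifP => h; rewrite ?mulr0 ?mulr1; lia.
- by rewrite /=; case: ifP => h; rewrite ?mulr0 ?mulr1; lia.
- by rewrite /=; case: ifP => h; rewrite ?mulr0 ?mulr1; lia.
Qed.

End Ascent.

Section RealAscent.
Variables (R : realType) (n : nat).
Hypothesis n_gt0 : (0 < n)%N.
Local Notation V := (gspvec R n).
Local Notation N := (2 * n)%N.
Local Notation rho := (@rho R n n_gt0).
Implicit Types (a b : gsp_root n) (k m : int) (x y : V) (l : coweight n)
  (s : weyl n).

Definition offset l s (i : 'I_N) : int :=
  N%:Z * crd l i - ((val s)^-1%g i)%:Z + i%:Z.

Lemma offsetE l s i :
  N%:R * crd (affine l s rho - rho) i = (offset l s i)%:~R.
Proof.
rewrite crdB crd_affine mulrBr mulrDr !crd_rho /offset.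
rewrite [RHS]rmorphD [X in _ = X + _]rmorphB [X in _ = X - _ + _]rmorphM /=.
by rewrite -!pmulrn; ring.
Qed.

(** Dual coordinates have sum A + B in the box, so that only the two coordinates
    of the pair that presents the root have to be bounded. *)
Lemma box_reflection A B a k x :
  in_box A B (x - rho) ->
  A%:~R <= crd x (val a).2 + k%:~R - crd rho (val a).1 <= B%:~R ->
  A%:~R <= crd x (val a).1 - k%:~R - crd rho (val a).2 <= B%:~R ->
  in_box A B (affine_reflection a k x - rho).
Proof.
move=> hx hp hq; pose y := affine_reflection a k x - rho.
have yE i : crd y i = crd (x - rho) i - level a k x * (crd (coroot int a)
  i)%:~R.
  rewrite /y affine_reflectionE !crdB crdZ (crd_coroot_int R); ring.
have ysum i : crd y i + crd y (rev_ord i) = (A + B)%:~R.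
  have [_ _ <-] := hx i; rewrite !yE crd_coroot_rev rmorphN /=; ring.
have byrev i : A%:~R <= crd y i <= B%:~R ->
    [/\ A%:~R <= crd y (rev_ord i), crd y (rev_ord i) <= B%:~R
      & crd y (rev_ord i) + crd y i = (A + B)%:~R].
  move=> /andP[h1 h2]; have := ysum i; rewrite rmorphD /= => h3.
  by split; lra.
have c1 : crd (coroot int a) (val a).1 = 1 by rewrite coroot_coef eqxx.
have c2 : crd (coroot int a) (val a).2 = -1.
  by rewrite coroot_coef rev_ord_neq eqxx eq_sym (negbTE (valP a)).
have yp : A%:~R <= crd y (val a).1 <= B%:~R.
  by rewrite yE c1 mulr1 crdB; move: hp; rewrite /level /pairing; lra.
have yq : A%:~R <= crd y (val a).2 <= B%:~R.
  by rewrite yE c2 mulrN1 crdB; move: hq; rewrite /level /pairing; lra.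
move=> i; rewrite -/y.
have [->|ip] := eqVneq i (val a).1; first by case/andP: yp => ? ?; split.
have [->|iq] := eqVneq i (val a).2; first by case/andP: yq => ? ?; split.
have [->|ip'] := eqVneq i (rev_ord (val a).1).
  by rewrite rev_ordK; apply: byrev.
have [->|iq'] := eqVneq i (rev_ord (val a).2).
  by rewrite rev_ordK; apply: byrev.
split=> //; rewrite yE coroot_coef (negbTE ip) (negbTE iq) (negbTE ip') (negbTE
  iq') /= mulr0 subr0;
  by case: (hx i).
Qed.

(** This is [integral_ascent] divided by 2n. *)
Lemma ascent A B l s :
  in_box A B (affine l s rho - rho) ->
  (forall i, crd (affine l s rho - rho) i = A%:~R
          \/ crd (affine l s rho - rho) i = B%:~R)
  \/ exists a k, 0 < level a k rho * level a k (affine l s rho)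
     /\ in_box A B (affine_reflection a k (affine l s rho) - rho).
Proof.
move=> hbox; have N0 : 0 < N%:R :> R by rewrite ltr0n; lia.
have scale (z z' : R) : (N%:R * z <= N%:R * z') = (z <= z') by rewrite ler_pM2l.
have NE (z : int) : N%:R * z%:~R = (N%:Z * z)%:~R :> R by rewrite rmorphM.
pose D := offset l s.
have hb i : N%:Z * A <= D i <= N%:Z * B.
  by rewrite -!(ler_int R) -offsetE -!NE !scale; case: (hbox i) => -> ->.
have hl i : crd l i + crd l (rev_ord i) = A + B.
  have [_ _ /(congr1 ( *%R N%:R))] := hbox i.
  rewrite mulrDr !offsetE NE -rmorphD => /intr_inj.
  rewrite /offset weylV_rev; move: ((val s)^-1%g i) => j.
  move: (crd l i) (crd l (rev_ord i)) => u v e.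
  apply: (@mulfI _ N%:Z); first by lia.
  rewrite -e mulrDr /=; have := ltn_ord j; have := ltn_ord i; lia.
have [/forallP ext|] :=
  boolP [forall i, (D i == N%:Z * A) || (D i == N%:Z * B)].
  left=> i; have := ext i => /orP[]/eqP e; [left|right];
    by apply: (mulfI (lt0r_neq0 N0)); rewrite offsetE NE -e.
rewrite negb_forall => /existsP[p]; rewrite negb_or => /andP[pA pB]; right.
have [q [k [pq pos hp hq]]] := integral_ascent (@perm_inj _ (val s)^-1%g)
  (weylV_rev s) hl (fun i => erefl (D i)) hb pA pB.
pose a : gsp_root n := Sub (p, q) (pq : (p, q).1 != (p, q).2).
exists a, k.
have yE i : N%:R * crd (affine l s rho) i = (D i)%:~R + N%:R * crd rho i.
  by rewrite -offsetE -mulrDr crdB subrK.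
have ylev : N%:R * level a k (affine l s rho)
    = ((D p - p%:Z) - (D q - q%:Z) - N%:Z * k)%:~R.
  rewrite /level /pairing !mulrBr !yE !crd_rho /=; move: (D p) (D q) => X Y.
  by rewrite !intrB intrM -!pmulrn; ring.
split.
  rewrite -(pmulr_rgt0 _ N0) -(pmulr_rgt0 _ N0).
  have -> : N%:R * (N%:R * (level a k rho * level a k (affine l s rho)))
    = (N%:R * level a k rho) * (N%:R * level a k (affine l s rho)) by ring.
  by rewrite level_rho ylev -rmorphM ltr0z.
apply: box_reflection => //.
  have e : N%:R * (crd (affine l s rho) q + k%:~R - crd rho p)
      = (D q - q%:Z + p%:Z + N%:Z * k)%:~R.
    rewrite mulrBr mulrDr yE !crd_rho; move: (D q) => Y.
    by rewrite intrD intrM intrD intrB -!pmulrn; ring.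
  by rewrite -[X in X && _]scale -[X in _ && X]scale e !NE !ler_int.
have e : N%:R * (crd (affine l s rho) p - k%:~R - crd rho q)
    = (D p - p%:Z + q%:Z - N%:Z * k)%:~R.
  rewrite !mulrBr yE !crd_rho; move: (D p) => X.
  by rewrite intrB intrM intrD intrB -!pmulrn; ring.
by rewrite -[X in X && _]scale -[X in _ && X]scale e !NE !ler_int.
Qed.

End RealAscent.

(** * Convex hulls, translations and orbits *)

Section Convexity.
Variables (R : realType) (n : nat).
Local Notation V := (gspvec R n).
Implicit Types (a : gsp_root n) (k : int) (x y z : V) (mu nu : coweight n)
  (s : weyl n).

Lemma refl_weylMK a : involutive (weylM (refl_weyl a)).
Proof.
move=> s; apply: val_inj; apply/permP => i.
by rewrite /= !permM !permE refl_ordK.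
Qed.

(** The hull is convex and stable under the linear reflection of a, and the
    point is (1 - t) x plus t times the image of x. *)
Lemma Conv_segment mu a (t : R) x :
  Conv mu x -> 0 <= t <= 1 -> Conv mu (x - (t * pairing a x) *: coroot R a).
Proof.
move=> [c [c0 c1 ->]] /andP[t0 t1].
pose h := weylM (refl_weyl a).
exists (fun s => (1 - t) * c s + t * c (h s)); split.
- by move=> s; rewrite addr_ge0 // mulr_ge0 // subr_ge0.
- have ch : \sum_s c (h s) = 1.
    by rewrite -[RHS]c1 [RHS](reindex_inj (inv_inj (refl_weylMK a))).
  by rewrite big_split /= -!mulr_sumr c1 ch !mulr1 subrK.
have -> (y : V) : y - (t * pairing a y) *: coroot R a
    = (1 - t) *: y + t *: weyl_act (refl_weyl a) y.
  rewrite refl_weylE; apply: gspvec_eq => i.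
  by rewrite crdB crdD !crdZ crdB crdZ; ring.
apply: gspvec_eq => j; rewrite crdD !crdZ crd_weyl !crd_combination.
under [RHS]eq_bigr do rewrite mulrDl -!mulrA.
rewrite big_split /= !mulr_sumr; congr (_ + _).
rewrite [LHS](reindex_inj (inv_inj (refl_weylMK a))).
apply: eq_bigr => s _; congr (_ * (_ * _%:~R)).
rewrite -[LHS]/(crd (weyl_act (weylM (refl_weyl a) s) mu)
  ((val (refl_weyl a))^-1%g j)) -[RHS]/(crd (weyl_act s mu) j).
by rewrite weyl_actM [LHS]crd_weyl !refl_weylV refl_ordK.
Qed.

Lemma crd_translation nu x i :
  crd (translation nu x) i = crd x i + (crd nu i)%:~R.
Proof. by rewrite /translation crdD crd_real. Qed.

Lemma translationD mu nu :
  @translation R n (mu + nu) = @translation R n mu \o @translation R n nu.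
Proof.
apply/funext => x; apply: gspvec_eq => i.
rewrite -[RHS]/(crd (translation mu (translation nu x)) i).
by rewrite !crd_translation crdD intrD addrAC addrA.
Qed.

Lemma Waff_coroot k a : @Waff R n (@translation R n (k *: coroot int a)).
Proof.
have -> : @translation R n (k *: coroot int a)
    = affine_reflection a k \o affine_reflection a 0.
  apply/funext => x; apply: gspvec_eq => i.
  rewrite -[RHS]/(crd (affine_reflection a k (affine_reflection a 0 x)) i).
  rewrite [in RHS]affine_reflectionE level_reflection pairing_corootxx.
  rewrite affine_reflectionE crd_translation !crdB !crdZ.
  by rewrite rmorphM /= -(crd_coroot_int R) /level; ring.
by apply: generated_comp; apply: generated1; do 2!eexists.
Qed.

(** Such a vector is an integral combination of coroots of long roots. *)
Lemma Waff_translation nu :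
  (forall i, crd nu i + crd nu (rev_ord i) = 0) ->
    @Waff R n (@translation R n nu).
Proof.
move=> h.
have long (i : 'I_(2 * n)) : (i, rev_ord i).1 != (i, rev_ord i).2
  by rewrite rev_ord_neq.
pose a i : gsp_root n := Sub (i, rev_ord i) (long i).
have -> : nu = \sum_(i < 2 * n | (i < n)%N) crd nu i *: coroot int (a i).
  apply: gspvec_eq => j; rewrite crd_sum.
  have z i : crd (crd nu i *: coroot int (a i)) j
     = crd nu i * (if i == j then 1 else if i == rev_ord j then -1 else 0).
    rewrite crdZ coroot_coef /= rev_ordK !orbb (eq_sym j) (eq_sym _ (rev_ord
      i)).
    by rewrite eq_rev_ord.
  under eq_bigr do rewrite z.
  have [jn|nj] := ltnP j n.
    rewrite (bigD1 j) //= eqxx mulr1 big1 ?addr0 // => i /andP[ilt /negbTE ij].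
    rewrite ij; case: eqP => [e|_]; rewrite ?mulr0 //.
    by move: ilt; rewrite e /=; lia.
  rewrite (bigD1 (rev_ord j)) /=; last by have := ltn_ord j; lia.
  rewrite eqxx eq_sym rev_ord_neq big1 ?addr0 => [|i /andP[ilt /negbTE ij]].
    by rewrite mulrN1; apply/eqP; rewrite -addr_eq0 h.
  rewrite ij; case: eqP => [e|_]; rewrite ?mulr0 //.
  by move: ilt; rewrite e ltnNge nj.
apply: (big_rec (fun v => @Waff R n (@translation R n v))) => [|i v _ hv].
  have -> : @translation R n 0 = idfun.
    apply/funext => x; apply: gspvec_eq => i.
    by rewrite crd_translation (_ : crd (0 : coweight n) i = 0) ?addr0 // mxE.
  by exists 0%N; constructor.
by rewrite translationD; apply: generated_comp hv; apply: Waff_coroot.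
Qed.

(** Exchange the dual coordinates at which nu and mu differ. *)
Lemma orbit_of_corners A B mu nu :
  block A B mu -> (forall i, crd nu i = A \/ crd nu i = B) ->
  (forall i, crd nu i + crd nu (rev_ord i) = A + B) -> weyl_orbit mu nu.
Proof.
move=> [AB hmu] hnu nurev.
pose f i : 'I_(2 * n) := if crd nu i == crd mu i then i else rev_ord i.
have murev i : crd mu i + crd mu (rev_ord i) = A + B.
  by rewrite !hmu /=; have := ltn_ord i; do 2![case: ifP]; lia.
have frev i : f (rev_ord i) = rev_ord (f i).
  rewrite /f; have -> : (crd nu (rev_ord i) == crd mu (rev_ord i))
    = (crd nu i == crd mu i).
    have := (nurev i, murev i) => -[];
      move: (crd nu _) (crd nu _) (crd mu _) (crd mu _); lia.
  by case: ifP.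
have fK : involutive f.
  by move=> i; rewrite {2}/f; case: ifP => e; rewrite ?frev {1}/f e ?rev_ordK.
have muf i : crd mu (f i) = crd nu i.
  rewrite /f; case: eqP => // ne; have := murev i; have := hnu i.
  by move: ne; rewrite !(hmu i); case: ifP; lia.
have hs : [forall i, perm (inv_inj fK) (rev_ord i) == rev_ord (perm (inv_inj
  fK) i)].
  by apply/forallP => i; rewrite !permE frev.
exists (Sub (perm (inv_inj fK)) hs : weyl n); apply: gspvec_eq => i;
  rewrite crd_weyl /=.
have -> : (perm (inv_inj fK))^-1%g i = f i.
  by apply: (@perm_inj _ (perm (inv_inj fK))); rewrite permKV permE fK.
by rewrite muf.
Qed.

(** Dominance makes mu_i - mu_(rev i) nonnegative for i < n, and minuscule makes
    it 0 or 1. Its parity is that of mu_i + mu_(rev i), which does not depend on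
    i. *)
Lemma block_minuscule mu : dominant mu -> minuscule mu ->
  exists A B, block A B mu.
Proof.
move=> dom minu.
have [n0|n_gt0] := posnP n.
  by exists 0, 0; split=> // -[i hi]; exfalso; move: hi; rewrite n0.
have step (i j : 'I_(2 * n)) : (i < n)%N -> j = i.+1 :> nat ->
  crd mu j <= crd mu i.
  move=> ilt e; have ij : (i, j).1 != (i, j).2 by rewrite eq_ordE /=; lia.
  have := dom (Sub (i, j) ij); rewrite /simple_root /pairing /= ilt e eqxx.
  by move=> /(_ isT); rewrite subr_ge0.
have pos (i : 'I_(2 * n)) : (i < n)%N -> crd mu (rev_ord i) <= crd mu i.
  have [d] := ubnP (n - i)%N; elim: d i => // d IH i hd ilt.
  have hj : (i.+1 < 2 * n)%N by lia.
  have hij := step i (Ordinal hj) ilt erefl.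
  have [e|ne] := eqVneq (i.+1) n.
    by have <- : Ordinal hj = rev_ord i by [apply: val_inj => /=; lia].
  have := IH (Ordinal hj); rewrite /= => /(_ _ _) hj'.
  have {}hj' : crd mu (rev_ord (Ordinal hj)) <= crd mu (Ordinal hj)
    by apply: hj'; lia.
  have := crd_rev mu i (Ordinal hj); move: hj' hij.
  move: (crd mu _) (crd mu _) (crd mu _) (crd mu _); lia.
have gap (i : 'I_(2 * n)) : (i < n)%N ->
    crd mu i = crd mu (rev_ord i) \/ crd mu i = crd mu (rev_ord i) + 1.
  move=> ilt; have ii : (i, rev_ord i).1 != (i, rev_ord i).2
    by rewrite rev_ord_neq.
  have := minu (Sub (i, rev_ord i) ii); rewrite /pairing /= !inE.
  have := pos i ilt; move: (crd mu _) (crd mu _) => u v; lia.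
have N_gt0 : (0 < 2 * n)%N by lia.
pose o := Ordinal N_gt0.
have const (i : 'I_(2 * n)) : (i < n)%N ->
    crd mu i = crd mu o /\ crd mu (rev_ord i) = crd mu (rev_ord o).
  move=> ilt; have := (gap i ilt, gap o n_gt0, crd_rev mu i o) => -[[]].
  move: (crd mu _) (crd mu _) (crd mu _) (crd mu _); lia.
exists (crd mu (rev_ord o)), (crd mu o); split; first exact: pos.
move=> i; case: ifP => [ilt|ige]; first by case: (const i ilt).
rewrite -[i in LHS]rev_ordK; case: (const (rev_ord i)) => [|_ //].
by rewrite /=; have := ltn_ord i; lia.
Qed.

Lemma block_sum mu : sum_of_dominant_minuscule mu -> exists A B, block A B mu.
Proof.
move=> [s [hs ->]]; elim: s hs => [|nu s IH] hs.
  exists 0, 0; rewrite big_nil; split=> // i.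
  by rewrite (_ : crd (0 : coweight n) i = 0) ?if_same // mxE.
have [|A [B [AB hAB]]] := IH; first by move=> v hv; apply: hs;
  rewrite inE hv orbT.
have [dom minu] := hs nu (mem_head _ _).
have [A' [B' [AB' hAB']]] := block_minuscule dom minu.
exists (A' + A), (B' + B); split; first exact: lerD.
by move=> i; rewrite big_cons crdD hAB hAB'; case: ifP.
Qed.

End Convexity.

(** * Climbing to a translation, and descending from one *)

Section Climbing.
Variables (R : realType) (n : nat).
Hypothesis n_gt0 : (0 < n)%N.
Local Notation V := (gspvec R n).
Local Notation N := (2 * n)%N.
Local Notation rho := (@rho R n n_gt0).
Local Notation S := (@Saff R n).
Implicit Types (a : gsp_root n) (k : int) (x y z : V) (l mu : coweight n)
  (s : weyl n) (w tau : V -> V).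

Definition norm2 x : R := \sum_i crd x i ^+ 2.

(** Coroots are proportional to roots for the Euclidean scalar product of V; the
    factor is 1 for long roots and 2 for short ones. *)
Lemma coroot_dot a :
  exists2 c : R, 0 < c & forall x, \sum_i crd x i * crd (coroot R a) i
    = c * pairing a x.
Proof.
have delta (x : V) j : \sum_i crd x i * (delta_mx 0 j : 'rV[R]_N) 0 i = crd x j.
  rewrite (bigD1 j) //= mxE !eqxx mulr1 big1 ?addr0 // => i /negbTE ij.
  by rewrite mxE ij andbF mulr0.
rewrite /coroot /= /coroot_val /pairing; case: (val a) => p q /=.
case: eqP => [->|_].
  exists 1 => // x; rewrite mul1r -!delta -sumrB; apply: eq_bigr => i _.
  by rewrite !mxE; ring.
exists 2 => // x.
transitivity (crd x p - crd x q + crd x (rev_ord q) - crd x (rev_ord p)).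
  rewrite -!delta -sumrB -big_split -sumrB /=; apply: eq_bigr => i _.
  by rewrite !mxE; ring.
by have := crd_rev x p q; lra.
Qed.

(** The square of the distance grows by a positive multiple of the product of
    the values of the affine root at x and y. *)
Lemma norm2_reflection a k x y :
  0 < level a k y * level a k x ->
  norm2 (x - y) < norm2 (affine_reflection a k x - y).
Proof.
move=> pos; have [c c0 hc] := coroot_dot a.
have -> : affine_reflection a k x - y = (x - y) - level a k x *: coroot R a.
  by rewrite affine_reflectionE addrAC.
have -> : norm2 (x - y - level a k x *: coroot R a)
  = norm2 (x - y) + 2 * c * (level a k y * level a k x).
  have e1 := hc (x - y); have := hc (coroot R a).
  rewrite pairing_coroot pairing_corootxx => e2.
  transitivity (norm2 (x - y) - 2 * level a k x * (c * pairing a (x - y))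
    + level a k x ^+ 2 * (c * 2%:~R)).
    have eN i : crd (x - y - level a k x *: coroot R a) i ^+ 2
      = crd (x - y) i ^+ 2 - 2 * level a k x * (crd (x - y) i * crd (coroot R
        a) i)
        + level a k x ^+ 2 * (crd (coroot R a) i * crd (coroot R a) i).
      by rewrite [LHS](congr1 (fun r => r ^+ 2) (crdB _ _ _)) crdZ; ring.
    by rewrite /norm2 (eq_bigr _ (fun i _ =>
      eN i)) big_split sumrB -!mulr_sumr e1 e2.
  by rewrite /level /pairing !crdB; ring.
by rewrite ltrDl mulr_gt0 // mulr_gt0.
Qed.

(** An integral multiple of the square of the distance from x(rho) to rho, see
    [spreadE]. *)
Definition spread l s : int := \sum_i offset l s i ^+ 2.

Lemma spreadE l s :
  N%:R ^+ 2 * norm2 (affine l s rho - rho) = (spread l s)%:~R.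
Proof.
rewrite /norm2 mulr_sumr /spread rmorph_sum; apply: eq_bigr => i _.
by rewrite -exprMn offsetE /= !expr2 intrM.
Qed.

Lemma spread_bound A B l s :
  in_box A B (affine l s rho - rho) ->
  spread l s <= N%:Z * (N%:Z * (`|A| + `|B|)) ^+ 2.
Proof.
move=> hbox; have N0 : 0 < N%:R :> R by rewrite ltr0n; lia.
have -> : N%:Z * (N%:Z * (`|A| + `|B|)) ^+ 2
    = \sum_(i < N) (N%:Z * (`|A| + `|B|)) ^+ 2.
  by rewrite sumr_const card_ord -mulr_natl natz.
apply: ler_sum => i _; rewrite -real_normK ?num_real //.
rewrite lerXn2r ?nnegrE ?normr_ge0 ?mulr_ge0 ?addr_ge0 //.
have [h1 h2 _] := hbox i.
have {}h1 : N%:Z * A <= offset l s i.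
  by rewrite -(ler_int R) -offsetE intrM ler_pM2l.
have {}h2 : offset l s i <= N%:Z * B.
  by rewrite -(ler_int R) -offsetE intrM ler_pM2l.
have hA : N%:Z * - `|A| <= N%:Z * A
  by rewrite ler_wpM2l // lerNl ler_normr lexx orbT.
have hB : N%:Z * B <= N%:Z * `|B| by rewrite ler_wpM2l // ler_norm.
have nA : 0 <= N%:Z * `|A| by rewrite mulr_ge0.
have nB : 0 <= N%:Z * `|B| by rewrite mulr_ge0.
rewrite mulrDr; move: hA; rewrite mulrN; lia.
Qed.

(** All offsets are divisible by 2n, so s maps indices to congruent ones. *)
Lemma translation_of_corners A B l s :
  (forall i, crd (affine l s rho - rho) i = A%:~R
          \/ crd (affine l s rho - rho) i = B%:~R) ->
  affine l s = @translation R n l /\ forall i, crd l i = A \/ crd l i = B.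
Proof.
move=> h; have N0 : (0 < N)%N by lia.
have off i : offset l s i = N%:Z * A \/ offset l s i = N%:Z * B.
  by case: (h i) => e; [left|right]; apply: (@intr_inj R);
    rewrite -offsetE e intrM.
have sid i : (val s)^-1%g i = i.
  apply/eqP; apply: contraT => ne.
  have hz (c : int) := ord_not_congruent (crd l i - c) ne.
  have := hz A; have := hz B; have := off i; rewrite /offset !mulrBr.
  by move: (N%:Z * _) (N%:Z * A) (N%:Z * B); lia.
split=> [|i].
  apply/funext => x; apply: gspvec_eq => i.
  by rewrite crd_affine crd_translation sid.
have := off i; rewrite /offset sid subrK => -[] /(mulfI _) e; [left|right];
  apply: e; lia.
Qed.

Lemma mul_gt0_trans (u v t : R) : 0 < u * v -> 0 < v * t -> 0 < u * t.
Proof.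
have [v0|v0|->] := ltgtP v 0; last by rewrite mulr0 ltxx.
  by rewrite nmulr_lgt0 // nmulr_rgt0 // => u0 t0; rewrite nmulr_lgt0.
by rewrite pmulr_lgt0 // pmulr_rgt0 // => u0 t0; rewrite mulr_gt0.
Qed.

(** Each step of [ascent] goes up in the Bruhat order and increases the spread,
    an integer that is bounded on the box. The step is found from the position
    of w tau rho, but the Bruhat order looks at that of w rho; no hyperplane
    separates the two, because rho and tau rho both lie in the base alcove. *)
Lemma climb A B tau w l s :
  base_alcove (tau rho) -> generated S w -> w \o tau = affine l s ->
  in_box A B (affine l s rho - rho) ->
  exists w' nu, [/\ generated S w', bruhat_le S w w', w' \o tau
    = @translation R n nu,
    forall i, crd nu i = A \/ crd nu i = B
    & forall i, crd nu i + crd nu (rev_ord i) = A + B].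
Proof.
move=> htau.
pose bound := N%:Z * (N%:Z * (`|A| + `|B|)) ^+ 2.
have [t] : exists t : nat, bound - spread l s < t
  by exists (`|bound - spread l s|%N).+1; lia.
elim: t w l s => [|t IH] w l s ht hw e hbox.
  by have := spread_bound hbox; rewrite -/bound; lia.
have [corners|[a [k [pos hbox']]]] := ascent hbox.
  have [el hl] := translation_of_corners corners.
  exists w, l; split=> //; [exact: rt_refl|by rewrite e|].
  move=> i; have [_ _] := hbox i; rewrite el !crdB !crd_translation => hi.
  by apply: (@intr_inj R); rewrite -hi intrD; ring.
have pos' : 0 < level a k rho * level a k (w rho).
  have [j /word_affine [l' [s' ew]]] := hw.
  apply: mul_gt0_trans pos _.
  rewrite -e mulrC [(w \o tau) _]/= ew !level_affine.
  exact: level_alcove_rho.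
have [l' [s' e']] : exists l' s', affine_reflection a k \o affine l s
  = @affine R n l' s'.
  by rewrite reflection_is_affine affineM; do 2!eexists.
have ex : affine_reflection a k (affine l s rho) = affine l' s' rho
  by rewrite -e'.
rewrite ex in hbox'.
have [||||w' [nu [h1 h2 h3 h4 h5]]] := IH (affine_reflection a k \o w) l' s'.
- have : (spread l s)%:~R < (spread l' s')%:~R :> R.
    have N0 : 0 < N%:R :> R by rewrite ltr0n; lia.
    by rewrite -!spreadE ltr_pM2l ?exprn_gt0 // -ex; apply: norm2_reflection.
  by rewrite (ltr_int R); lia.
- by apply: generated_comp hw; apply: reflection_generated.
- by rewrite -e' -e.
- by [].
exists w', nu; split=> //; apply: rt_trans h2; apply: rt_step.
exact: bruhat_step_up.
Qed.

Lemma Waff_generated w : Waff w -> generated S w.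
Proof. by apply: generated_sub => _ [a [k ->]];
  apply: reflection_generated. Qed.

Lemma generated_Waff w : generated S w -> Waff w.
Proof.
by apply: generated_sub => _ /SaffP[b [m [_ ->]]]; apply: generated1;
  exists b, m.
Qed.

Lemma Waff_Wext w : Waff w -> Wext w.
Proof. by move=> /Waff_generated[j /word_affine[l [s ->]]]; exists l, s. Qed.

Lemma Wext_comp (u v : V -> V) : Wext u -> Wext v -> Wext (u \o v).
Proof.
move=> [l [s ->]] [l' [s' ->]].
exists (l + weyl_act s l'), (weylM s s'); exact: affineM.
Qed.

Lemma permissible_admissible A B mu (x : V -> V) :
  block A B mu -> Perm R mu x -> Adm R mu x.
Proof.
move=> hmu [tau [htau hmt [w [hw ex]] hx]].
have [l [s el]] : Wext x by rewrite ex; apply: Wext_comp (Waff_Wext hw) htau.1.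
have rtau : base_alcove (tau rho).
  by rewrite -htau.2; exists rho => //; apply: rho_alcove.
split; first by exists l, s.
rewrite el in hx ex *.
have hbox : in_box A B (affine l s rho - rho) by apply: permissible_box hmu hx.
have [w' [nu [h1 h2 h3 h4 h5]]] :=
  climb rtau (Waff_generated hw) (esym ex) hbox.
exists nu; split; first exact: orbit_of_corners hmu h4 h5.
by exists w, w', tau; split=> //; split=> //; exact: generated_Waff.
Qed.

(** As y and z are on the same side of the hyperplane, y - z lies on the
    segment from s_H y - z to its image under the linear reflection. *)
Lemma Conv_descent mu a k y z :
  0 <= level a k z -> 0 <= level a k y ->
  Conv mu (affine_reflection a k y - z) -> Conv mu (y - z).
Proof.
move=> hz hy hc; pose y' := affine_reflection a k y.
have ey : y = y' + level a k y *: coroot R a.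
  by rewrite /y' affine_reflectionE subrK.
have [s0|s0] := eqVneq (level a k y + level a k z) 0.
  have y0 : level a k y = 0 by lra.
  by rewrite ey y0 scale0r addr0.
have ep : pairing a (y' - z) = - (level a k y + level a k z).
  by rewrite opprD -(level_reflectionxx a k y) -/y' /level /pairing !crdB; ring.
have -> : y - z = y' - z - ((level a k y / (level a k y + level a k z))
    * pairing a (y' - z)) *: coroot R a.
  by rewrite ep mulrN mulfVK // scaleNr opprK addrAC -ey.
apply: Conv_segment hc _; apply/andP; split;
  first by rewrite divr_ge0 // addr_ge0.
rewrite ler_pdivrMr ?mul1r ?lerDl //.
by rewrite lt_neqAle eq_sym s0 addr_ge0.
Qed.

Lemma bruhat_Conv mu tau z (u v : V -> V) :
  Omega tau -> closed_base_alcove z -> bruhat_le S u v ->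
  Conv mu (v (tau z) - z) -> Conv mu (u (tau z) - z).
Proof.
move=> [[lt [st et]] htau] hz.
have rtau : base_alcove (tau rho).
  by rewrite -htau; exists rho => //; apply: rho_alcove.
elim=> // {u v} [u v|u v w _ IH1 _ IH2 /IH2 /IH1 //].
move=> /(bruhat_step_inv n_gt0)[a [k [-> [j /word_affine [l [s eu]]] pos]]].
have pos' : 0 < level a k rho * level a k (u (tau rho)).
  apply: mul_gt0_trans pos _; rewrite eu !level_affine.
  exact: level_alcove_rho.
(* Pass to the opposite affine root if necessary. *)
wlog p : a k pos pos' / 0 < level a k rho => [wl|].
  have := level_rho_neq0 R n_gt0 a k; rewrite neq_lt => /orP[p|p];
    last exact: wl.
  rewrite -reflection_opp; apply: wl; rewrite !level_opp ?mulrNN //.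
  by rewrite oppr_gt0.
move=> hc; apply: (@Conv_descent mu a k) hc.
  exact: level_closure_ge0 p.
move: pos'; rewrite pmulr_rgt0 // eu et /=.
rewrite -[affine l s _]/((affine l s \o affine lt st) rho).
rewrite -[affine l s (_ _)]/((affine l s \o affine lt st) z) affineM
  !level_affine.
exact: level_closure_ge0.
Qed.

Lemma admissible_permissible A B mu (x : V -> V) :
  block A B mu -> Adm R mu x -> Perm R mu x.
Proof.
move=> hmu [_ [nu [[s enu] [w [w' [tau [[hw hw' htau ex enu'] hle]]]]]]].
exists tau; split=> //.
- exists (@translation R n (mu - nu) \o w'); split; last first.
    by rewrite -compA -enu' -translationD subrK.
  apply: generated_comp hw'; apply: Waff_translation => i.
  have [_ _] := block_orbit s i hmu; rewrite !crdB enu;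
    move: (hmu.2 i) (hmu.2 (rev_ord i)) => -> -> /=.
  by have := ltn_ord i; do 2![case: ifP]; lia.
- by exists w.
- move=> z [hz _]; rewrite ex; apply: bruhat_Conv htau hz hle _.
  rewrite -[w' (tau z)]/((w' \o tau) z) -enu' /translation addrAC subrr add0r
    enu.
  (* The translation moves z by a point of the orbit. *)
  exists (fun t => (t == s)%:R); split=> [t||].
  + exact: ler0n.
  + by rewrite (bigD1 s) //= eqxx big1 ?addr0 // => t /negbTE ->.
  + by rewrite (bigD1 s) //= eqxx scale1r big1 ?addr0 // => t /negbTE ->;
    rewrite scale0r.
Qed.

End Climbing.

Theorem theorem4 (R : realType) (n : nat) (n_gt0 : (0 < n)%N)
    (mu : coweight n) (mu_sum : sum_of_dominant_minuscule mu) :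
  Adm R mu = Perm R mu.
Proof.
have [A [B hmu]] := block_sum mu_sum; apply/seteqP; split=> x.
  exact: admissible_permissible hmu.
exact: permissible_admissible hmu.
Qed.
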